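(* Let $n\ge2$ and $\kappa>0$. For every $u\in C_c^\infty(\mathbb H^n(-\kappa))$ and every $R>0$, $$\int_{\mathbb H^n(-\kappa)-B_R(\mathbf 0)}|\nabla u|^2\,dv_{g_\kappa}\ \ge\ \int_{\mathbb H^n(-\kappa)-B_R(\mathbf 0)}\Big\{\frac{(n-1)^2\kappa}{4}+\frac1{4r^2}+\frac{(n-1)(n-3)\kappa}{4\sinh^2(\sqrt\kappa\, r)}\Big\}u^2\,dv_{g_\kappa}.$$ In particular, $$\int_{\mathbb H^n(-\kappa)}|\nabla u|^2\,dv_{g_\kappa}\ \ge\ \int_{\mathbb H^n(-\kappa)}\Big\{\frac{(n-1)^2\kappa}{4}+\frac1{4r^2}+\frac{(n-1)(n-3)\kappa}{4\sinh^2(\sqrt\kappa\, r)}\Big\}u^2\,dv_{g_\kappa}.$$ Here $r(x):=\mathrm{dist}_{g_\kappa}(x,\mathbf 0)$.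
   Context: $\mathbb H^n(-\kappa)=(\mathbb H^n(-\kappa),g_\kappa)$ is the hyperbolic $n$-space of constant sectional curvature $-\kappa$, $\mathbf 0$ is a fixed origin in it, $B_R(\mathbf 0)$ is the open geodesic ball of radius $R$ centered at $\mathbf 0$, $dv_{g_\kappa}$ is the Riemannian volume measure, and $\nabla u$ is the gradient of $u$. *)

(* Defs.v *)
From HB Require Import structures.
From mathcomp Require Import all_boot all_order all_algebra.
From mathcomp Require Import all_classical all_reals all_analysis.

Set Implicit Arguments.
Unset Strict Implicit.
Unset Printing Implicit Defensive.

Import Order.TTheory GRing.Theory Num.Theory.
Import numFieldNormedType.Exports.

Local Open Scope classical_set_scope.
Local Open Scope ring_scope.

Definition rV_display : measure_display.
Proof. exact: default_measure_display. Qed.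

Section measurable_rV.
Context {R : realType} (n : nat).

(* Product sigma-algebra on R^n, i.e. its Borel sigma-algebra. *)
Let coord (i : 'I_n) (x : 'rV[R]_n) : measurableTypeR R := x 0 i.

Let rV_set0 : g_sigma_preimage coord set0.
Proof. exact: sigma_algebra0. Qed.

Let rV_setC A : g_sigma_preimage coord A -> g_sigma_preimage coord (~` A).
Proof. exact: sigma_algebraC. Qed.

Let rV_bigcup (F : _^nat) : (forall i, g_sigma_preimage coord (F i)) ->
  g_sigma_preimage coord (\bigcup_i (F i)).
Proof. exact: sigma_algebra_bigcup. Qed.

HB.instance Definition _ := @isMeasurable.Build rV_display
  'rV[R]_n (g_sigma_preimage coord) rV_set0 rV_setC rV_bigcup.

Lemma measurable_rV_coord (i : 'I_n) :
  measurable_fun [set: 'rV[R]_n] (fun x => x 0 i : measurableTypeR R).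
Proof.
move=> _ Y mY; rewrite setTI; apply: sub_sigma_algebra => /=.
rewrite -bigcup_seq/=; exists i => /=; first by rewrite mem_index_enum.
by exists Y => //; rewrite setTI.
Qed.

Lemma measurable_fun_rVP d (T : measurableType d) (f : T -> 'rV[R]_n) :
  (forall i, measurable_fun [set: T] (fun t => f t 0 i : measurableTypeR R)) ->
  measurable_fun [set: T] f.
Proof.
move=> mf _ B mB.
suff: g_sigma_preimage (fun i => coord i \o f) `<=` measurable.
  by rewrite g_sigma_preimage_comp; apply; exists B.
apply: smallest_sub; first exact: sigma_algebra_measurable.
rewrite -bigcup_seq; apply: bigcup_sub => i _.
by move=> A [C mC <-]; exact: mf.
Qed.

End measurable_rV.

Section lebesgue_rV.
Context {R : realType}.

Definition rV_cons n (p : measurableTypeR R * 'rV[R]_n) : 'rV[R]_n.+1 :=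
  row_mx (p.1%:M : 'rV_1) p.2.

Definition rV_uncons n (x : 'rV[R]_n.+1) : measurableTypeR R * 'rV[R]_n :=
  (x 0 ord0, \row_j x 0 (lift ord0 j)).

Lemma rV_cons0 n p : @rV_cons n p 0 ord0 = p.1.
Proof.
have -> : (ord0 : 'I_n.+1) = lshift n (ord0 : 'I_1) by exact/val_inj.
by rewrite (@row_mxEl _ 1 1 n) mxE eqxx mulr1n.
Qed.

Lemma rV_consS n p j : @rV_cons n p 0 (lift ord0 j) = p.2 0 j.
Proof.
have -> : lift ord0 j = rshift 1 j :> 'I_n.+1 by exact/val_inj.
by rewrite (@row_mxEr _ 1 1 n).
Qed.

Lemma rV_consK n : cancel (@rV_cons n) (@rV_uncons n).
Proof.
case=> a y; rewrite /rV_uncons rV_cons0; congr pair.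
by apply/rowP => j; rewrite mxE rV_consS.
Qed.

Lemma measurable_rV_cons n : measurable_fun setT (@rV_cons n).
Proof.
apply: measurable_fun_rVP => i.
have [j ->|->] := unliftP ord0 i.
  under eq_fun do rewrite rV_consS.
  by apply: (measurableT_comp (measurable_rV_coord j)); exact: measurable_snd.
by under eq_fun do rewrite rV_cons0; exact: measurable_fst.
Qed.

Lemma measurable_rV_uncons n : measurable_fun setT (@rV_uncons n).
Proof.
apply/measurable_fun_pairP; split; first exact: (measurable_rV_coord ord0).
apply: measurable_fun_rVP => j /=.
by under eq_fun do rewrite mxE; exact: measurable_rV_coord.
Qed.

HB.instance Definition _ n :=
  isMeasurableFun.Build _ _ _ _ (@rV_cons n) (@measurable_rV_cons n).

Section step.
Local Open Scope ereal_scope.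
Variables (n : nat) (mu : {sigma_finite_measure set 'rV[R]_n -> \bar R}).

Definition lebesgue_rV_step : set 'rV[R]_n.+1 -> \bar R :=
  pushforward (@lebesgue_measure R \x mu) (@rV_cons n).

Let step0 : lebesgue_rV_step set0 = 0.
Proof. exact: measure0. Qed.

Let step_ge0 A : 0 <= lebesgue_rV_step A.
Proof. exact: measure_ge0. Qed.

Let step_sigma_additive : semi_sigma_additive lebesgue_rV_step.
Proof. exact: measure_semi_sigma_additive. Qed.

HB.instance Definition _ := isMeasure.Build _ _ _ lebesgue_rV_step
  step0 step_ge0 step_sigma_additive.

Let step_sigma_finite : sigma_finite setT lebesgue_rV_step.
Proof.
have /sigma_finiteP[F [FT ndF Foo]] := sigma_finiteT (@lebesgue_measure R).
have /sigma_finiteP[G [GT ndG Goo]] := sigma_finiteT mu.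
exists (fun k => @rV_uncons n @^-1` (F k `*` G k)).
  rewrite -preimage_bigcup (_ : \bigcup_k _ = setT) ?preimage_setT//.
  rewrite -setXTT FT GT predeqE => -[x y]; split.
    by move=> [n0 _ []/= ? ?]; split; exists n0.
  move=> [/= [i _ Fi] [j _ Gj]]; exists (maxn i j) => //; split.
  - by move: x Fi; exact/subsetPset/ndF/leq_maxl.
  - by move: y Gj; exact/subsetPset/ndG/leq_maxr.
move=> k; have [mF Fk] := Foo k; have [mG Gk] := Goo k; split.
  rewrite -[X in measurable X]setTI.
  by apply: measurable_rV_uncons => //; exact: measurableX.
rewrite /lebesgue_rV_step /pushforward -comp_preimage.
rewrite (_ : _ \o _ = id); last by rewrite funeqE => p /=; rewrite rV_consK.
by rewrite product_measure1E// lte_mul_pinfty// ge0_fin_numE.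
Qed.

HB.instance Definition _ := Measure_isSigmaFinite.Build _ _ _ lebesgue_rV_step
  step_sigma_finite.

End step.

(* Lebesgue measure on R^n, as the n-fold product of Lebesgue measure on R
   (R^0 is a point of mass 1); see lebesgue_rV_box. *)
Fixpoint lebesgue_rV (n : nat) : {sigma_finite_measure set 'rV[R]_n -> \bar R} :=
  match n with
  | 0 => @dirac _ 'rV[R]_0 0 R
  | m.+1 => lebesgue_rV_step (lebesgue_rV m)
  end.

Lemma lebesgue_rV_box n (B : 'I_n -> set (measurableTypeR R)) :
  (forall i, measurable (B i)) ->
  lebesgue_rV n [set x | forall i, B i (x 0 i)] =
  (\prod_(i < n) lebesgue_measure (B i))%E.
Proof.
elim: n B => [|n IHn] B mB.
  by rewrite big_ord0 /= diracE mem_set // => -[].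
rewrite big_ord_recl -IHn; last by move=> i; exact: mB.
rewrite /= /lebesgue_rV_step /pushforward.
have mC : measurable [set x : 'rV[R]_n | forall i, B (lift ord0 i) (x 0 i)].
  rewrite (_ : mkset _ = \bigcap_(i in [set: 'I_n])
     ((fun x : 'rV[R]_n => x 0 i : measurableTypeR R) @^-1` B (lift ord0 i))).
    apply: fin_bigcap_measurable; first exact: finite_finset.
    by move=> i _; rewrite -[X in measurable X]setTI; exact: measurable_rV_coord.
  by apply/seteqP; split=> x /= + i => /(_ i)//; apply.
rewrite -product_measure1E //; congr (_ \x _)%E.
apply/seteqP; split=> -[a y] /=.
  move=> h; split; first by have := h ord0; rewrite rV_cons0.
  by move=> i; have := h (lift ord0 i); rewrite rV_consS.
move=> [h0 hS] i; have [j ->|->] := unliftP ord0 i.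
  by rewrite rV_consS; exact: hS.
by rewrite rV_cons0.
Qed.

End lebesgue_rV.

(* Riemannian geometry of an open set U of R^n, seen as a manifold with a single
   chart; G x is the Gram matrix (g_ij) of the metric at x. Only the values of
   G and of functions at points of U matter. *)
Section riemannian.
Context {R : realType} {n : nat}.
Implicit Types (U D : set 'rV[R]_n) (G : 'rV[R]_n -> 'M[R]_n).

Definition riem_dot G (x v w : 'rV[R]_n) : R := (v *m G x *m w^T) 0 0.

Definition riem_norm G (x v : 'rV[R]_n) : R := Num.sqrt (riem_dot G x v v).

Definition partial (i : 'I_n) (f : 'rV[R]_n -> R) : 'rV[R]_n -> R :=
  fun x => 'D_(delta_mx 0 i) f x.

(* (grad f)^j = \sum_i g^ij d_i f *)
Definition riem_grad G (f : 'rV[R]_n -> R) (x : 'rV[R]_n) : 'rV[R]_n :=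
  (\row_i partial i f x) *m invmx (G x).

(* The integral over D against the volume measure dv = sqrt (det g) dx. *)
Definition riem_integral G D (f : 'rV[R]_n -> R) : \bar R :=
  \int[lebesgue_rV n]_(x in D) (f x * Num.sqrt (\det (G x)))%:E.

(* A C^1 arc is parametrised by [0, 1]; asking that it extend to a C^1 map on R
   is no restriction and avoids one-sided derivatives. *)
Definition C1_arc U (c : R -> 'rV[R]_n) : Prop :=
  [/\ forall t, derivable c t 1, continuous (derive1 c)
    & forall t, 0 <= t <= 1 -> U (c t)].

Definition arc_length G (c : R -> 'rV[R]_n) : R :=
  \int[lebesgue_measure]_(t in `[0, 1]%classic) riem_norm G (c t) (derive1 c t).

(* Piecewise C^1 curves from x to y in U, as lists of consecutive C^1 arcs. *)
Fixpoint joins U (x y : 'rV[R]_n) (p : seq (R -> 'rV[R]_n)) : Prop :=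
  if p is c :: p' then [/\ C1_arc U c, c 0 = x & joins U (c 1) y p']
  else x = y.

Definition riem_dist U G (x y : 'rV[R]_n) : R :=
  inf [set \sum_(c <- p) arc_length G c | p in joins U x y].

Definition riem_ball U G (x : 'rV[R]_n) (rho : R) : set 'rV[R]_n :=
  [set y | U y /\ riem_dist U G y x < rho].

(* All iterated partial derivatives exist and are continuous on U. *)
Definition smooth_on U (f : 'rV[R]_n -> R) : Prop :=
  forall (s : seq 'I_n) (x : 'rV[R]_n), U x ->
    {for x, continuous (foldr partial f s)} /\
    forall i, derivable (foldr partial f s) x (delta_mx 0 i).

Definition smooth_compact_support U (f : 'rV[R]_n -> R) : Prop :=
  smooth_on U f /\
  exists K : set 'rV[R]_n,
    [/\ compact K, K `<=` U & forall x, U x -> ~ K x -> f x = 0].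

End riemannian.

(* The Poincare ball model of the hyperbolic n-space of curvature -kappa: the
   Euclidean unit ball with g = 4 |dx|^2 / (kappa (1 - |x|^2)^2), and the centre
   of the ball as origin. *)
Section hyperbolic.
Context {R : realType}.

(* The library's norm on 'rV[R]_n is the sup norm. *)
Definition euclid_norm {n} (x : 'rV[R]_n) : R := Num.sqrt (\sum_i x 0 i ^+ 2).

Definition hyp_space (n : nat) : set 'rV[R]_n := [set x | euclid_norm x < 1].
Arguments hyp_space : clear implicits.

Definition hyp_metric (n : nat) (kappa : R) (x : 'rV[R]_n) : 'M[R]_n :=
  (4 / (kappa * (1 - euclid_norm x ^+ 2) ^+ 2))%:M.

Definition hyp_ball (n : nat) (kappa rho : R) : set 'rV[R]_n :=
  riem_ball (hyp_space n) (hyp_metric kappa) 0 rho.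

Arguments hyp_ball : clear implicits.

Definition hyp_r (n : nat) (kappa : R) (x : 'rV[R]_n) : R :=
  riem_dist (hyp_space n) (hyp_metric kappa) x 0.

Definition hyp_grad_norm (n : nat) (kappa : R) (u : 'rV[R]_n -> R)
    (x : 'rV[R]_n) : R :=
  riem_norm (hyp_metric kappa) x (riem_grad (hyp_metric kappa) u x).

Definition hyp_integral (n : nat) (kappa : R) (D : set 'rV[R]_n)
    (f : 'rV[R]_n -> R) : \bar R :=
  riem_integral (hyp_metric kappa) D f.

Definition sinh (t : R) : R := (expR t - expR (- t)) / 2.

End hyperbolic.

Arguments hyp_space {R} n _.
Arguments hyp_ball {R} n kappa rho _.

(* Main.v *)
(* A ground state estimate. Let W be the weight of the theorem, n the dimension
   and phi = r^(1/2) sinh(sqrt kappa r)^(-(n-1)/2). Then - Delta phi = W phi, hence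
     |grad u|^2 - W u^2 = |grad u - u grad (log phi)|^2 + div (u^2 grad (log phi)).
   Since log phi is radially nonincreasing, the divergence has a nonnegative
   integral outside every ball around the origin. To avoid a boundary integral,
   the divergence is multiplied by a C^1 nondecreasing radial cutoff, for which
   only integrals of partial derivatives of compactly supported functions occur,
   and the cutoffs then decrease to the indicator function of the exterior
   domain. The whole space is the limit of exterior domains, as W >= 0. The
   distance to the origin x |-> 2 artanh |x| / sqrt kappa of the ball model is
   found by comparing curves with the functions y |-> artanh <y, e>. *)
Require Import Defs.
From mathcomp Require Import all_boot all_order all_algebra.
From mathcomp Require Import all_classical all_reals all_analysis.
From mathcomp Require Import measurable_realfun.
From mathcomp Require Import ring lra.

Set Implicit Arguments.
Unset Strict Implicit.
Unset Printing Implicit Defensive.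

Import Order.TTheory GRing.Theory Num.Theory.
Import numFieldNormedType.Exports.

Local Open Scope classical_set_scope.
Local Open Scope ring_scope.

(** * Borel sets of R^n *)

Section borel_rV.
Context {R : realType} {n : nat}.
Implicit Types (A D : set 'rV[R]_n) (f : 'rV[R]_n -> R).

(** The ground state comes from two one-dimensional facts, taken here at [kappa = 1]. Conjugating by
    the square root of the volume density [J = sinh(r)^(n-1)] turns [- Delta] on radial functions
    into [- d^2/dr^2 + (J^(1/2))'' / J^(1/2)], and this quotient is
    [(n-1)^2/4 + (n-1)(n-3)/(4 sinh(r)^2)]. The function [f = r^(1/2)] solves [- f'' = f/(4 r^2)],
    the equation behind the one-dimensional Hardy inequality. Dividing [r^(1/2)] by [J^(1/2)] gives
    [phi], and the three terms of the weight add up. The ball model is conformally flat, so the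
    claim becomes an inequality between Lebesgue integrals on R^n in which [kappa] contributes only
    a common factor. Radial quantities are written in [s = |x|^2], whose partial derivatives [2 x_i]
    are polynomial. Two singularities must be kept away: that of [log phi] at the origin, by cutoffs
    vanishing near it, and that of the conformal factor on the unit sphere, by extending [u] by zero
    from its compact support. *)

Lemma measurable_rV_forall (B : 'I_n -> set (measurableTypeR R)) :
  (forall i, measurable (B i)) ->
  measurable [set x : 'rV[R]_n | forall i, B i (x 0 i)].
Proof.
move=> mB; rewrite (_ : mkset _ = \bigcap_(i in [set: 'I_n])
    ((fun x : 'rV[R]_n => x 0 i : measurableTypeR R) @^-1` B i)).
  apply: fin_bigcap_measurable; first exact: finite_finset.
  by move=> i _; rewrite -[X in measurable X]setTI; exact: measurable_rV_coord.
by apply/seteqP; split=> x /= + i => /(_ i)//; apply.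
Qed.

(** The sigma-algebra on ['rV[R]_n] is generated by the coordinates, so an open set is exhibited as
    the countable union of the cubes with rational centre and radius [1/(j+1)] that it contains. *)
Lemma open_measurable_rV A : open A -> measurable A.
Proof.
move=> oA.
pose B (p : 'rV[rat]_n * nat) : set 'rV[R]_n :=
  [set x | forall i, (ratr (p.1 0 i) - p.2.+1%:R^-1 : R) < x 0 i
                     < ratr (p.1 0 i) + p.2.+1%:R^-1].
have mB p : measurable (B p).
  apply: (@measurable_rV_forall (fun i => `](ratr (p.1 0 i) - p.2.+1%:R^-1),
    (ratr (p.1 0 i) + p.2.+1%:R^-1)[%classic)) => i.
  exact: measurable_itv.
rewrite (_ : A = \bigcup_p (if `[< B p `<=` A >] then B p else set0)).
  apply: countable_bigcupT_measurable; first exact: countableP.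
  by move=> p; case: ifPn.
apply/seteqP; split=> [x Ax|x [p _]]; last first.
  by case: ifPn => // /asboolP; apply.
have /nbhs_ballP[e /= e0 xe] : nbhs x A by exact: open_nbhs_nbhs.
have e20 : 0 < e / 2 by rewrite divr_gt0.
have [k _ /(_ _ (leqnn k))/= ke] := near_infty_natSinv_lt (PosNum e20).
have kgt0 : 0 < k.+1%:R^-1 :> R by rewrite invr_gt0.
have /choice[q qx] : forall i, exists q : rat,
    ratr q \in `](x 0 i - k.+1%:R^-1), (x 0 i + k.+1%:R^-1)[.
  by move=> i; apply: rat_in_itvoo; rewrite ltrD2l gtrN.
exists (\row_i q i, k) => //.
rewrite asboolT.
  move=> i /=; rewrite mxE; move: (qx i); rewrite in_itv/= => /andP[? ?].
  by rewrite ltrBlDr; apply/andP; split=> //; rewrite -ltrBlDr.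
move=> y By; apply: xe; split => // i j; rewrite (ord1 i).
move: (By j) (qx j); rewrite /= mxE in_itv/= /ball/= ltr_norml => + +.
move: (k.+1%:R^-1) ke kgt0 => d; lra.
Qed.

Lemma open_continuous_measurable_fun_rV A f : open A ->
  (forall x, A x -> {for x, continuous f}) -> measurable_fun A f.
Proof.
move=> oA cf; apply: (measurability _ (RGenOpens.measurableE R)).
move=> _ [_ [a [b ->] <-]].
apply: open_measurable_rV.
rewrite openE => x [Ax fx]; apply: filterI; first exact: open_nbhs_nbhs.
by apply: (cf _ Ax); apply: open_nbhs_nbhs; split => //; exact: interval_open.
Qed.

Lemma continuous_measurable_fun_rV f :
  continuous f -> measurable_fun setT f.
Proof.
by move=> cf; apply: open_continuous_measurable_fun_rV;
  [exact: openT|move=> x _; exact: cf].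
Qed.

End borel_rV.

Lemma cvg_rVP {R : realType} {T : Type} {F : set_system T} {FF : Filter F} n
    (f : T -> 'rV[R]_n) (l : 'rV[R]_n) :
  (forall i, f x 0 i @[x --> F] --> l 0 i) -> f x @[x --> F] --> l.
Proof.
move=> fl; apply/cvg_ballP => e e0.
have : \forall x \near F, forall i, ball (l 0 i) e (f x 0 i).
  by apply: filter_forall => i; move/cvg_ballP : (fl i); apply.
by apply: filterS => x xl; split => // j i; rewrite (ord1 j).
Qed.

(** * Integrals of partial derivatives *)

Section derive_line.
Context {R : realType} {V V' : normedModType R}.
Variables (g : V -> R) (phi : V' -> V) (x v : V') (w : V).
Hypothesis phiE : forall t : R, phi (t *: v + x) = t *: w + phi x.

Let quotE : (fun t : R => t^-1 *: (((g \o phi) \o shift x) (t *: v) - (g \o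
  phi) x)) =
  (fun t : R => t^-1 *: ((g \o shift (phi x)) (t *: w) - g (phi x))).
Proof. by apply/funext => t /=; rewrite phiE. Qed.

(** Both difference quotients are the same function of [t]. This transports directional derivatives
    to slices and lines without asking for differentiability of [g] or [phi]. *)
Lemma derivable_line : derivable g (phi x) w -> derivable (g \o phi) x v.
Proof. by rewrite /derivable quotE. Qed.

Lemma derive_line : 'D_v (g \o phi) x = 'D_w g (phi x).
Proof. by rewrite /derive quotE. Qed.

End derive_line.

Section bounded_support.
Context {R : realType}.

(** Phrased by coordinates so that slices in either factor of [rV_cons] inherit the same [M]. *)
Definition bounded_support n (f : 'rV[R]_n -> R) :=
  exists M : R, forall (x : 'rV[R]_n) (i : 'I_n), M < `|x 0 i| -> f x = 0.

Lemma bounded_support_integrable n (f : 'rV[R]_n -> R) :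
  continuous f -> bounded_support f ->
  (lebesgue_rV n).-integrable setT (EFin \o f).
Proof.
move=> cf [M fM].
pose I := `[(- `|M|), `|M|]%classic : set R.
pose C := [set x : 'rV[R]_n | forall i, I (x 0 i)].
have mC : measurable C.
  by apply: (@measurable_rV_forall _ _ (fun=> I)) => i; exact: measurable_itv.
have cC : compact C by apply: (@rV_compact _ _ (fun=> I)) => i;
  exact: segment_compact.
have -> : EFin \o f = (EFin \o f) \_ C.
  apply/funext => x; rewrite patchE; case: ifPn => //.
  rewrite notin_setE => /existsNP[i]; rewrite /I/= in_itv/= -ler_norml => /negP.
  by rewrite -ltNge => Mx; rewrite /= (fM x i)// (le_lt_trans (ler_norm _) Mx).
apply: (integrable_mkcond _ mC).1.
apply: (measurable_bounded_integrable mC).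
- suff : (lebesgue_rV n C < +oo)%E by [].
  have -> : (lebesgue_rV n C = \prod_(i < n) lebesgue_measure I)%E.
    by apply: (lebesgue_rV_box (B := fun=> I)) => i; exact: measurable_itv.
  have : (\prod_(i < n) lebesgue_measure I)%E \is a fin_num.
    elim/big_ind : _ => // [a b|i _]; first exact: fin_numM.
    by rewrite /I lebesgue_measure_itv/=; case: ifP.
  by move/fin_numPlt => /andP[].
- exact: measurable_funTS (continuous_measurable_fun_rV cf).
- have : compact (f @` C).
    apply: continuous_compact => //; exact: continuous_subspaceT.
  move/compact_bounded => [N [Nr fN]]; exists N; split => // y /fN {}fN x Cx.
  by apply: fN; exists x.
Qed.

Lemma integral_derive1_eq0 (f : R -> R) (M : R) :
  (forall x, derivable f x 1) -> continuous (derive1 f) ->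
  (forall x, M < `|x| -> f x = 0) ->
  (\int[lebesgue_measure]_x ((derive1 f) x)%:E = 0)%E.
Proof.
move=> df cf fM.
(* The strict inequality [M < N] makes [f] vanish at both ends, and [0 < N] makes [[- N, N]]
   nondegenerate. *)
pose N : R := `|M| + 1.
have N0 : 0 < N by rewrite ltr_wpDl.
have MN : M < N by rewrite (le_lt_trans (ler_norm _))// ltrDl.
have f'0 x : N < `|x| -> (derive1 f) x = 0.
  move=> Nx; rewrite derive1E -(derive_cst (0 : R) x 1).
  apply: near_eq_derive; near=> y => /=.
  apply: fM; apply: (lt_trans MN); near: y.
  by apply: (cvgr_gt `|x|) => //; exact: norm_continuous.
pose J : set R := `[- N, N]%classic.
transitivity (\int[lebesgue_measure]_(x in J) ((derive1 f) x)%:E)%E.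
  rewrite [RHS]integral_mkcond; apply: eq_integral => x _.
  rewrite patchE; case: ifPn => //;
    rewrite notin_setE /J/= in_itv/= -ler_norml => /negP.
  by rewrite -ltNge => /f'0 ->.
have cf0 : continuous f.
  by move=> x; apply/differentiable_continuous/derivable1_diffP/df.
rewrite (@continuous_FTC2 R (derive1 f) f (- N) N).
- have e0 (a : R) : N <= `|a| -> f a = 0 by move=> Na; apply: fM;
  exact: lt_le_trans Na.
  by rewrite !e0 ?subee// ?normrN ger0_norm// ltW.
- by rewrite gtrN.
- exact: continuous_subspaceT.
- split; first by move=> x _; exact: df.
  + by apply: cvg_at_right_filter; exact: cf0.
  + by apply: cvg_at_left_filter; exact: cf0.
Unshelve. all: by end_near. Qed.

Lemma bounded_support_partial n (i : 'I_n) (f : 'rV[R]_n -> R) :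
  bounded_support f -> bounded_support (partial i f).
Proof.
move=> [M fM]; exists M => x j Mx.
rewrite /partial -(derive_cst (0 : R) x (delta_mx 0 i)).
apply: near_eq_derive; near=> y => /=.
apply: (fM _ j); near: y.
apply: (cvgr_gt `|x 0 j|) => //.
apply: (@continuous_comp _ _ _ (fun y : 'rV[R]_n => y 0 j) Num.norm).
  exact: coord_continuous.
exact: norm_continuous.
Unshelve. all: by end_near. Qed.

Lemma continuous_rV_cons n (a : R) :
  continuous (fun y : 'rV[R]_n => rV_cons (a, y)).
Proof.
move=> y; apply: (@cvg_rVP _ _ (nbhs y)) => i.
have [j ->|->] := unliftP ord0 i.
  under eq_fun do rewrite rV_consS; rewrite rV_consS.
  exact: coord_continuous.
by under eq_fun do rewrite rV_cons0; rewrite rV_cons0; exact: cvg_cst.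
Qed.

Lemma continuous_rV_consl n (y : 'rV[R]_n) :
  continuous (fun a : R => rV_cons (a, y)).
Proof.
move=> a; apply: (@cvg_rVP _ _ (nbhs a)) => i.
have [j ->|->] := unliftP ord0 i.
  by under eq_fun do rewrite rV_consS; rewrite rV_consS; exact: cvg_cst.
by under eq_fun do rewrite rV_cons0; rewrite rV_cons0; exact: cvg_id.
Qed.

(** The divergence theorem without boundary. Fubini splits off the first coordinate: for a later
    [i], the inner integral over the remaining coordinates vanishes by induction; for the first one,
    the inner integral over the line vanishes by the fundamental theorem of calculus. *)
Lemma integral_partial_eq0 n (i : 'I_n) (f : 'rV[R]_n -> R) :
  (forall x, derivable f x (delta_mx 0 i)) -> continuous (partial i f) ->
  bounded_support f ->
  (\int[lebesgue_rV n]_x (partial i f x)%:E = 0)%E.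
Proof.
elim: n => [|n IHn] in i f *; first by case: i.
move=> df cf bf.
have mcons := @measurable_rV_cons R n.
have mpf : measurable_fun [set: 'rV[R]_n.+1] (fun x => (partial i f x)%:E).
  by apply/measurable_EFinP; exact: continuous_measurable_fun_rV.
have intf : (lebesgue_measure \x lebesgue_rV n)%E.-integrable setT
    (fun p => (partial i f (rV_cons p))%:E).
  apply/integrableP; split; first exact: (measurableT_comp mpf mcons).
  have /integrableP[_] := bounded_support_integrable cf
    (bounded_support_partial i bf).
  rewrite [X in (X < _)%E -> _](ge0_integral_pushforward mcons)//.
  by apply/measurableT_comp.
have [M fM] := bf.
rewrite [LHS](integral_pushforward mcons)//= preimage_setT.
have [j ij|i0] := unliftP ord0 i.
  rewrite -integral12_prod_meas1//= /fubini_F.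
  apply: integral0_eq => a _ /=.
  have consE y (t : R) : rV_cons (a, t *: delta_mx 0 j + y) =
      t *: delta_mx 0 i + rV_cons (a, y).
    apply/rowP => k; rewrite [RHS]mxE ij.
    have [l ->|->] := unliftP ord0 k.
      by rewrite !rV_consS !mxE /= (inj_eq lift_inj).
    by rewrite !rV_cons0 !mxE /= mulr0 add0r.
  pose h := f \o (fun y : 'rV[R]_n => rV_cons (a, y)).
  have hE : partial j h = fun y => partial i f (rV_cons (a, y)).
    by apply/funext => y; exact: (derive_line (phi := fun y => rV_cons (a,
      y)) f (consE y)).
  transitivity (\int[lebesgue_rV n]_y (partial j h y)%:E)%E; first by rewrite hE.
  apply: IHn.
  - move=> y; apply: (derivable_line (phi := fun y => rV_cons (a, y)) (consE y)).
    exact: df.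
  - rewrite hE => y.
    apply: (@continuous_comp _ _ _ (fun y => rV_cons (a, y)) (partial i f)).
      exact: continuous_rV_cons.
    exact: cf.
  - by exists M => y k My; apply: (fM _ (lift ord0 k)); rewrite rV_consS.
rewrite -integral21_prod_meas1//= /fubini_G.
apply: integral0_eq => y _ /=.
have consE (a : R) (t : R) : rV_cons (t *: (1 : R) + a, y) =
    t *: delta_mx 0 i + rV_cons (a, y).
  apply/rowP => k; rewrite [RHS]mxE i0.
  have [l ->|->] := unliftP ord0 k.
    by rewrite !rV_consS !mxE /= mulr0 add0r.
  by rewrite !rV_cons0 !mxE.
pose h := f \o (fun a : R => rV_cons (a, y)).
have hE : derive1 h = fun a => partial i f (rV_cons (a, y)).
  apply/funext => a; rewrite derive1E.
  exact: (derive_line (phi := fun a => rV_cons (a, y)) f (consE a)).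
transitivity (\int[lebesgue_measure]_a (derive1 h a)%:E)%E; first by rewrite hE.
apply: (@integral_derive1_eq0 _ M).
- move=> a; apply: (derivable_line (phi := fun a => rV_cons (a, y)) (consE a)).
  exact: df.
- rewrite hE => a.
  apply: (@continuous_comp _ _ _ (fun a => rV_cons (a, y)) (partial i f)).
    exact: continuous_rV_consl.
  exact: cf.
- by move=> a Ma; apply: (fM _ ord0); rewrite rV_cons0.
Qed.

End bounded_support.

(** * The ball model and its distance *)

Section euclidean.
Context {R : realType} {n : nat}.
Implicit Types x y v e : 'rV[R]_n.

Definition dotv x y : R := \sum_i x 0 i * y 0 i.

Definition sqnorm x : R := \sum_i x 0 i ^+ 2.

Lemma dotvv x : dotv x x = sqnorm x.
Proof. by apply: eq_bigr => i _; rewrite expr2. Qed.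

Lemma sqnorm_ge0 x : 0 <= sqnorm x.
Proof. by apply: sumr_ge0 => i _; exact: sqr_ge0. Qed.

Lemma euclid_norm_ge0 x : 0 <= euclid_norm x.
Proof. exact: sqrtr_ge0. Qed.

Lemma euclid_norm_sqr x : euclid_norm x ^+ 2 = sqnorm x.
Proof. exact/sqr_sqrtr/sqnorm_ge0. Qed.

Lemma dotvZl a x y : dotv (a *: x) y = a * dotv x y.
Proof. by rewrite mulr_sumr; apply: eq_bigr => i _; rewrite mxE mulrA. Qed.

Lemma dotvZr a x y : dotv x (a *: y) = a * dotv x y.
Proof. by rewrite mulr_sumr; apply: eq_bigr => i _; rewrite mxE mulrCA. Qed.

(** Cauchy-Schwarz, from [0 <= |v - <v, e> e|^2]. Asking only [|e| <= 1] admits [e = 0], the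
    direction assigned to the origin below. *)
Lemma dotv_sqr_le v e : sqnorm e <= 1 -> dotv v e ^+ 2 <= sqnorm v.
Proof.
move=> e1; have [d dE] : exists d, d = dotv v e by exists (dotv v e).
rewrite -dE.
have : 0 <= \sum_i (v 0 i - d * e 0 i) ^+ 2.
  by apply: sumr_ge0 => i _; exact: sqr_ge0.
have -> : \sum_i (v 0 i - d * e 0 i) ^+ 2 = sqnorm v - 2 * d * d + d ^+ 2 *
  sqnorm e.
  rewrite [X in _ - X](_ : _ = \sum_i 2 * d * (v 0 i * e 0 i)); last first.
    by rewrite -mulr_sumr dE.
  rewrite /sqnorm mulr_sumr -sumrB -big_split/=.
  by apply: eq_bigr => i _; ring.
have := ler_wpM2l (sqr_ge0 d) e1; lra.
Qed.

Lemma dotv_norm_le v e : sqnorm e <= 1 -> `|dotv v e| <= euclid_norm v.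
Proof.
move=> /(dotv_sqr_le v) ve.
by rewrite -sqrtr_sqr; apply: ler_wsqrtr.
Qed.

Lemma continuous_sum (T : topologicalType) (m : nat) (f : 'I_m -> T -> R) (t : T) :
  (forall i, {for t, continuous (f i)}) ->
  {for t, continuous (fun t => \sum_i f i t)}.
Proof.
move=> cf; rewrite -fct_sumE.
elim/big_ind : _ => //; first exact: cvg_cst.
by move=> g h cg ch; exact: cvgD.
Qed.

Lemma continuous_sqnorm : continuous sqnorm.
Proof.
move=> x; apply: continuous_sum => i.
apply: (@continuous_comp _ _ _ (fun y : 'rV[R]_n => y 0 i) (fun a : R => a ^+ 2)).
  exact: coord_continuous.
exact: exprn_continuous.
Qed.

Lemma continuous_euclid_norm : continuous (@euclid_norm R n).
Proof.
move=> x; apply: (continuous_comp (@continuous_sqnorm x)).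
exact: sqrt_continuous.
Qed.

Lemma hyp_spaceE x : hyp_space n x = (sqnorm x < 1) :> Prop.
Proof.
rewrite /hyp_space/=; congr is_true.
by rewrite -euclid_norm_sqr expr_lt1// euclid_norm_ge0.
Qed.

Lemma open_hyp_space : open (hyp_space n : set 'rV[R]_n).
Proof.
have -> : hyp_space n = sqnorm @^-1` [set y | y < 1] :> set 'rV[R]_n.
  by apply/funext => x; rewrite hyp_spaceE.
by apply: open_comp => // x _; exact: continuous_sqnorm.
Qed.

Lemma riem_norm_hyp kappa x v : 0 < kappa -> sqnorm x < 1 ->
  riem_norm (hyp_metric kappa) x v =
  2 / (1 - sqnorm x) * euclid_norm v / Num.sqrt kappa.
Proof.
move=> k0 x1; have d0 : 0 < 1 - sqnorm x by rewrite subr_gt0.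
rewrite /riem_norm /riem_dot /hyp_metric.
rewrite (euclid_norm_sqr x) mul_mx_scalar -scalemxAl mxE.
rewrite (_ : (v *m v^T) 0 0 = sqnorm v); last first.
  by rewrite mxE; apply: eq_bigr => i _; rewrite mxE expr2.
rewrite -[RHS]ger0_norm; last first.
  by rewrite !mulr_ge0 ?invr_ge0 ?sqrtr_ge0 ?euclid_norm_ge0// ltW.
rewrite -[RHS]sqrtr_sqr; congr Num.sqrt.
rewrite !exprMn !exprVn (sqr_sqrtr (ltW k0)) (euclid_norm_sqr v).
by field; rewrite !gt_eqF.
Qed.

End euclidean.

(** * Hyperbolic lengths of curves and the distance to the origin *)

Section hyperbolic_distance.
Context {R : realType}.

(* The distance from the origin to a point at Euclidean distance [q] is
   [artanh2 q] when kappa = 1. *)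
Definition artanh2 (q : R) : R := ln (1 + q) - ln (1 - q).

Lemma is_derive_artanh2 (p : R -> R) (t dp : R) : `|p t| < 1 ->
  is_derive t 1 p dp ->
  is_derive t 1 (artanh2 \o p) (2 * dp / (1 - p t ^+ 2)).
Proof.
rewrite ltr_norml => /andP[p1 p2] Hp.
have h1 : 0 < 1 + p t by lra.
have h2 : 0 < 1 - p t by lra.
have d1 : is_derive t 1 (fun t => 1 + p t) (0 + dp) by exact: is_deriveD.
have d2 : is_derive t 1 (fun t => 1 - p t) (0 - dp) by exact: is_deriveB.
have D1 := @is_derive1_comp R (@ln R) (fun t => 1 + p t) t _ _ (is_derive1_ln
  h1) d1.
have D2 := @is_derive1_comp R (@ln R) (fun t => 1 - p t) t _ _ (is_derive1_ln
  h2) d2.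
apply: (@is_derive_eq _ _ _ (artanh2 \o p) t 1 _ _ (is_deriveB D1 D2)).
rewrite (_ : 1 - p t ^+ 2 = (1 + p t) * (1 - p t)); last by ring.
by field; rewrite !gt_eqF.
Qed.

Lemma continuous_artanh2_derive (p p' : R -> R) (t : R) : `|p t| < 1 ->
  {for t, continuous p} -> {for t, continuous p'} ->
  {for t, continuous (fun t => 2 * p' t / (1 - p t ^+ 2))}.
Proof.
rewrite ltr_norml => /andP[p1 p2] cp cp'.
apply: cvgM; first by apply: cvgM => //; exact: cvg_cst.
apply: cvgV; first by rewrite gt_eqF//; nra.
apply: cvgB; first exact: cvg_cst.
by apply: (@continuous_comp _ _ _ p (fun a : R => a ^+ 2)) => //;
  exact: exprn_continuous.
Qed.

Lemma Rintegral_artanh2 (p : R -> R) :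
  (forall t : R, derivable p t 1) -> continuous (derive1 p) ->
  (forall t : R, 0 <= t <= 1 -> `|p t| < 1) ->
  \int[lebesgue_measure]_(t in `[0, 1]%classic) (2 * derive1 p t / (1 - p t ^+ 2))
  = artanh2 (p 1) - artanh2 (p 0).
Proof.
move=> dp cp' p1.
have cp : continuous p.
  by move=> t; apply/differentiable_continuous/derivable1_diffP/dp.
have dF (t : R) : 0 <= t <= 1 ->
    is_derive t 1 (artanh2 \o p) (2 * derive1 p t / (1 - p t ^+ 2)).
  by move=> /p1 pt; apply: is_derive_artanh2 => //; rewrite derive1E;
    exact: derivableP.
have cF (t : R) : 0 <= t <= 1 -> {for t, continuous (artanh2 \o p)}.
  move=> /dF[+ _]; move=> dt.
  by apply/differentiable_continuous/derivable1_diffP.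
rewrite /Rintegral.
have -> := @continuous_FTC2 R (fun t => 2 * derive1 p t / (1 - p t ^+ 2))
  (artanh2 \o p) 0 1 ltr01.
- by [].
- apply: continuous_in_subspaceT => t; rewrite inE/= in_itv/= => /p1 pt.
  by apply: (continuous_artanh2_derive pt); [exact: cp|exact: cp'].
- split.
  + by move=> t; rewrite in_itv/= => /andP[/ltW t0 /ltW t1];
    have /dF[] : 0 <= t <= 1 by rewrite t0.
  + by apply: cvg_at_right_filter; apply: cF; rewrite lexx ler01.
  + by apply: cvg_at_left_filter; apply: cF; rewrite lexx ler01.
- move=> t; rewrite in_itv/= => /andP[/ltW t0 /ltW t1].
  rewrite derive1E; apply: derive_val; apply: dF; exact/andP.
Qed.

End hyperbolic_distance.

Section hyperbolic_arcs.
Context {R : realType} {n : nat}.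
Implicit Types (c : R -> 'rV[R]_n) (e x : 'rV[R]_n) (kappa t : R).

Let I01 := `[0, 1]%classic : set R.

Lemma derive1_coord c t i : derivable c t 1 ->
  is_derive t 1 (fun t => c t 0 i) (derive1 c t 0 i).
Proof.
move=> dc; split; first exact: ((derivable_mxP c t 1).1 dc).
by rewrite derive1E derive_mx// mxE.
Qed.

Lemma is_derive_dotv c e t : derivable c t 1 ->
  is_derive t 1 (fun t => dotv (c t) e) (dotv (derive1 c t) e).
Proof.
move=> dc.
have h i : is_derive t 1 (fun t => c t 0 i * e 0 i) (derive1 c t 0 i * e 0 i).
  apply: (@is_derive_eq _ _ _ _ _ _ _ _
    (is_deriveM (derive1_coord i dc) (is_derive_cst (e 0 i) t 1))).
  by rewrite scaler0 add0r /GRing.scale/= mulrC.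
have := is_derive_sum h.
by rewrite fct_sumE.
Qed.

Lemma continuous_dotv e : continuous (fun x => dotv x e).
Proof.
move=> x; apply: continuous_sum => i.
by apply: (@cvgM _ _ (nbhs x)); [exact: coord_continuous|exact: cvg_cst].
Qed.

Lemma C1_arc_continuous U c : C1_arc U c -> continuous c.
Proof.
by move=> [dc _ _] t; apply/differentiable_continuous/derivable1_diffP.
Qed.

Lemma sqnorm_dotv_lt1 x e : sqnorm e <= 1 -> sqnorm x < 1 -> `|dotv x e| < 1.
Proof.
move=> e1 x1; rewrite -(@expr_lt1 _ 2)// real_normK ?num_real//.
exact: le_lt_trans (dotv_sqr_le _ e1) x1.
Qed.

Lemma hyp_speed_integrable c : C1_arc (hyp_space n) c ->
  lebesgue_measure.-integrable I01
    (EFin \o (fun t => 2 / (1 - sqnorm (c t)) * euclid_norm (derive1 c t))).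
Proof.
move=> Cc; have [dc cc' Uc] := Cc; have cc := C1_arc_continuous Cc.
apply: continuous_compact_integrable; first exact: segment_compact.
apply: continuous_in_subspaceT => t; rewrite inE /I01/= in_itv/= => /Uc.
rewrite hyp_spaceE => ct.
apply: cvgM.
  apply: cvgM; first exact: cvg_cst.
  apply: cvgV; first by rewrite gt_eqF// subr_gt0.
  apply: cvgB; first exact: cvg_cst.
  apply: (@continuous_comp _ _ _ c sqnorm); [exact: cc|exact: continuous_sqnorm].
apply: (@continuous_comp _ _ _ (derive1 c) euclid_norm); [exact: cc'|].
exact: continuous_euclid_norm.
Qed.

Lemma arc_length_hyp kappa c : 0 < kappa -> C1_arc (hyp_space n) c ->
  Num.sqrt kappa * arc_length (hyp_metric kappa) c =
  \int[lebesgue_measure]_(t in I01)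
    (2 / (1 - sqnorm (c t)) * euclid_norm (derive1 c t)).
Proof.
move=> k0 Cc; have [_ _ Uc] := Cc.
rewrite /arc_length.
under eq_Rintegral => t.
  rewrite inE /I01/= in_itv/= => /Uc; rewrite hyp_spaceE => ct.
  rewrite riem_norm_hyp//; over.
rewrite RintegralZr//; last exact: hyp_speed_integrable.
by rewrite mulrCA divff ?mulr1// sqrtr_eq0 -ltNge.
Qed.

Lemma Rintegral_dotv c e : C1_arc (hyp_space n) c -> sqnorm e <= 1 ->
  \int[lebesgue_measure]_(t in I01)
    (2 * dotv (derive1 c t) e / (1 - dotv (c t) e ^+ 2)) =
  artanh2 (dotv (c 1) e) - artanh2 (dotv (c 0) e).
Proof.
move=> [dc cc' Uc] e1; pose p t := dotv (c t) e.
have p'E : derive1 p = fun t => dotv (derive1 c t) e.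
  by apply/funext => t; rewrite derive1E; apply: derive_val; exact: is_derive_dotv.
have := @Rintegral_artanh2 R p; rewrite p'E; apply.
- by move=> t; case: (is_derive_dotv e (dc t)).
- move=> t; apply: (@continuous_comp _ _ _ (derive1 c) (dotv ^~ e)).
    exact: cc'.
  exact: continuous_dotv.
- by move=> t /Uc; rewrite hyp_spaceE; exact: sqnorm_dotv_lt1.
Qed.

(* Along a curve, [y |-> artanh2 <y, e>] is 1-Lipschitz for the metric of
   curvature -1 and, unlike the distance to the origin, smooth. *)
Lemma arc_length_ge kappa c e : 0 < kappa -> sqnorm e <= 1 ->
  C1_arc (hyp_space n) c ->
  artanh2 (dotv (c 1) e) - artanh2 (dotv (c 0) e)
  <= Num.sqrt kappa * arc_length (hyp_metric kappa) c.
Proof.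
move=> k0 e1 Cc; have [dc cc' Uc] := Cc; have cc := C1_arc_continuous Cc.
rewrite arc_length_hyp// -Rintegral_dotv//.
apply: le_Rintegral; [exact: measurable_itv| |exact: hyp_speed_integrable|].
  apply: continuous_compact_integrable; first exact: segment_compact.
  apply: continuous_in_subspaceT => t; rewrite inE /I01/= in_itv/= => /Uc.
  rewrite hyp_spaceE => /(sqnorm_dotv_lt1 e1) pt.
  apply: (@continuous_artanh2_derive R (fun t => dotv (c t) e)
    (fun t => dotv (derive1 c t) e) t pt).
    apply: (@continuous_comp _ _ _ c (dotv ^~ e));
      [exact: cc|exact: continuous_dotv].
  apply: (@continuous_comp _ _ _ (derive1 c) (dotv ^~ e)); [exact: cc'|].
  exact: continuous_dotv.
move=> t; rewrite /I01/= in_itv/= => /Uc; rewrite hyp_spaceE => ct.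
have pc := dotv_sqr_le (c t) e1.
have p'c := le_trans (ler_norm _) (dotv_norm_le (derive1 c t) e1).
have E0 := euclid_norm_ge0 (derive1 c t).
have d1 : 0 < 1 - sqnorm (c t) by rewrite subr_gt0.
have d2 : 0 < 1 - dotv (c t) e ^+ 2 by rewrite subr_gt0 (le_lt_trans pc).
(* Cauchy-Schwarz enters twice: for the velocity in the numerator, then for the position in the
   denominator. *)
apply: (@le_trans _ _ (2 * euclid_norm (derive1 c t) / (1 - dotv (c t) e ^+ 2))).
  by rewrite ler_pM2r ?invr_gt0// ler_pM2l.
rewrite mulrAC; apply: ler_wpM2r => //; apply: ler_wpM2l => //.
by rewrite lef_pV2 ?posrE// lerB.
Qed.

Lemma artanh2N (q : R) : artanh2 (- q) = - artanh2 q.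
Proof. by rewrite /artanh2 opprK opprB. Qed.

Lemma artanh20 : artanh2 0 = 0 :> R.
Proof. by rewrite /artanh2 addr0 subr0 subrr. Qed.

Lemma joins_length_ge kappa x y e p : 0 < kappa -> sqnorm e <= 1 ->
  joins (hyp_space n) x y p ->
  artanh2 (dotv y e) - artanh2 (dotv x e)
  <= Num.sqrt kappa * \sum_(c <- p) arc_length (hyp_metric kappa) c.
Proof.
move=> k0 e1; elim: p x => [x ->|c p IHp x [Cc <- /IHp pl]].
  by rewrite big_nil mulr0 subrr.
rewrite big_cons mulrDr; have := arc_length_ge k0 e1 Cc; lra.
Qed.

(** The sign makes it point from [x] to the origin, the orientation of the curves that define
    [hyp_r]. As [0^-1 = 0], [dir 0 = 0]. *)
Let dir x : 'rV[R]_n := - (euclid_norm x)^-1 *: x.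

Let sqnorm_dir x : sqnorm (dir x) <= 1.
Proof.
rewrite -dotvv dotvZl dotvZr dotvv -euclid_norm_sqr.
have [->|x0] := eqVneq (euclid_norm x) 0; first by rewrite expr0n/= !mulr0.
by rewrite [leLHS](_ : _ = 1)//; field.
Qed.

Let dotv_dir x : dotv x (dir x) = - euclid_norm x.
Proof.
rewrite dotvZr dotvv -euclid_norm_sqr mulNr.
have [->|x0] := eqVneq (euclid_norm x) 0; first by rewrite expr0n/= !mulr0.
by field.
Qed.

Lemma C1_arc_segment x : hyp_space n x ->
  C1_arc (hyp_space n) (fun t => (1 - t) *: x) /\
  derive1 (fun t => (1 - t) *: x) = cst (- x).
Proof.
rewrite hyp_spaceE => x1.
have dcoord t i : is_derive t 1 (fun t => (1 - t) * x 0 i) (- x 0 i).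
  have d1 : is_derive t (1 : R) (fun t => 1 - t) (0 - 1) by exact: is_deriveB.
  apply: (@is_derive_eq _ _ _ _ _ _ _ _
    (is_deriveM d1 (is_derive_cst (x 0 i) t 1))).
  by rewrite scaler0 add0r sub0r scalerN /GRing.scale/= mulr1.
have ds t : derivable (fun t => (1 - t) *: x) t 1.
  apply/derivable_mxP => i j; rewrite (ord1 i).
  under eq_fun do rewrite mxE.
  by case: (dcoord t j).
have d1E : derive1 (fun t => (1 - t) *: x) = cst (- x).
  apply/funext => t; rewrite derive1E derive_mx//; apply/rowP => j; rewrite !mxE.
  under eq_fun do rewrite mxE.
  by apply: derive_val.
split; last exact: d1E.
split; [exact: ds|by rewrite d1E => t; exact: cvg_cst|].
move=> t /andP[t0 t1]; rewrite hyp_spaceE -dotvv dotvZl dotvZr dotvv.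
apply: le_lt_trans x1; rewrite mulrA ler_piMl ?sqnorm_ge0//; nra.
Qed.

(** The lower bound given by [joins_length_ge] for the direction [dir x] is attained by the radial
    segment: its position and velocity are multiples of [dir x], so that both uses of Cauchy-Schwarz
    are equalities. *)
Lemma hyp_rE kappa x : 0 < kappa -> hyp_space n x ->
  Num.sqrt kappa * hyp_r kappa x = artanh2 (euclid_norm x).
Proof.
move=> k0 x1; have sk0 : 0 < Num.sqrt kappa by rewrite sqrtr_gt0.
have [Cs s'E] := C1_arc_segment x1.
have join_segment : joins (hyp_space n) x 0 [:: fun t => (1 - t) *: x].
  by split; rewrite ?subr0 ?scale1r ?subrr ?scale0r.
have lengthE : Num.sqrt kappa * arc_length (hyp_metric kappa) (fun t => (1 - t)
  *: x)
    = artanh2 (euclid_norm x).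
  rewrite arc_length_hyp//.
  have dE : dotv (- x) (dir x) = euclid_norm x.
    by rewrite -scaleN1r dotvZl dotv_dir mulN1r opprK.
  transitivity (\int[lebesgue_measure]_(t in I01)
    (2 * dotv (derive1 (fun t => (1 - t) *: x) t) (dir x)
     / (1 - dotv ((1 - t) *: x) (dir x) ^+ 2))).
    apply: eq_Rintegral => t _; rewrite s'E /= dE dotvZl dotv_dir.
    rewrite mulrN sqrrN exprMn euclid_norm_sqr.
    rewrite -(dotvv ((1 - t) *: x)) dotvZl dotvZr dotvv mulrA -expr2 mulrAC.
    congr (_ * _ / _).
    rewrite /euclid_norm; congr Num.sqrt; apply: eq_bigr => i _.
    by rewrite mxE sqrrN.
  rewrite Rintegral_dotv// subrr scale0r subr0 scale1r dotv_dir artanh2N opprK.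
  rewrite (_ : dotv 0 _ = 0) ?artanh20 ?add0r//.
  by rewrite /dotv big1// => i _; rewrite mxE mul0r.
set A := [set \sum_(c <- p) arc_length (hyp_metric kappa) c
         | p in joins (hyp_space n) x 0].
have lbA : lbound A (artanh2 (euclid_norm x) / Num.sqrt kappa).
  move=> _ [p /(joins_length_ge k0 (sqnorm_dir x)) + <-].
  rewrite dotv_dir artanh2N opprK (_ : dotv 0 _ = 0) ?artanh20 ?add0r//.
    by rewrite ler_pdivrMr// mulrC.
  by rewrite /dotv big1// => i _; rewrite mxE mul0r.
have As : A (artanh2 (euclid_norm x) / Num.sqrt kappa).
  exists [:: fun t => (1 - t) *: x] => //.
  by rewrite big_seq1 -lengthE mulrC mulKf// gt_eqF.
suff -> : hyp_r kappa x = artanh2 (euclid_norm x) / Num.sqrt kappa.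
  by rewrite mulrC divfK// gt_eqF.
apply/eqP; rewrite eq_le; apply/andP; split.
  by apply: ge_inf => //; exists (artanh2 (euclid_norm x) / Num.sqrt kappa).
by apply: lb_le_inf => //; exists (artanh2 (euclid_norm x) / Num.sqrt kappa).
Qed.

End hyperbolic_arcs.

(** * Radial functions *)

Section real_calculus.
Context {R : realType}.
Implicit Types (f g : R -> R) (t a b s : R).

Lemma is_derive_mul (V : normedModType R) (f g : V -> R) (x w : V) df dg :
  is_derive x w f df -> is_derive x w g dg ->
  is_derive x w (fun y => f y * g y) (df * g x + f x * dg).
Proof.
move=> Hf Hg; apply: (@is_derive_eq _ _ _ _ x w _ _ (is_deriveM Hf Hg)).
by rewrite /GRing.scale/= addrC (mulrC (g x)).
Qed.

Lemma is_derive_inv f t df : f t != 0 -> is_derive t 1 f df ->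
  is_derive t 1 (fun t => (f t)^-1) (- df / f t ^+ 2).
Proof.
move=> f0 Hf; apply: (@is_derive_eq _ _ _ _ t 1 _ _ (is_deriveV f0 Hf)).
by rewrite /GRing.scale/= !mulNr mulrC.
Qed.

Lemma is_derive_pow f (k : nat) t df : is_derive t 1 f df ->
  is_derive t 1 (fun t => f t ^+ k.+1) (k.+1%:R * f t ^+ k * df).
Proof.
move=> Hf; rewrite (_ : (fun t => _) = f ^+ k.+1); last by rewrite exprfctE.
exact: is_deriveX.
Qed.

Lemma is_derive_continuous f t df : is_derive t 1 f df -> {for t, continuous f}.
Proof. by case=> d _; apply/differentiable_continuous/derivable1_diffP. Qed.

Lemma is_derive_ge0_le f (f' : R -> R) b : 0 <= b ->
  (forall t, 0 <= t <= b -> is_derive t 1 f (f' t)) ->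
  (forall t, 0 <= t <= b -> 0 <= f' t) -> f 0 <= f b.
Proof.
move=> b0 df f'0; have [||c] := @MVT_segment R f f' 0 b b0.
- by move=> t; rewrite in_itv/= => /andP[/ltW t0 /ltW tb]; apply: df; rewrite t0.
- apply: continuous_in_subspaceT => t; rewrite inE/= in_itv/= => tb.
  exact: is_derive_continuous (df _ tb).
- rewrite in_itv/= => /f'0 c0 fE.
  by rewrite -subr_ge0 fE mulr_ge0// subr0.
Qed.

(** Squaring removes the corner of the positive part and leaves a C^1 function, from which the
    cutoffs are built. *)
Definition pospart2 t : R := Num.max 0 t ^+ 2.

Lemma continuous_pospart : continuous (fun t => Num.max 0 t).
Proof.
by move=> t; apply: (@continuous_max R R (cst 0) id);
  [exact: cvg_cst|exact: cvg_id].
Qed.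

Lemma is_derive_pospart2 t : is_derive t 1 pospart2 (2 * Num.max 0 t).
Proof.
have [t0|t0|->] := ltgtP t 0.
- rewrite mulr0; apply: (@near_eq_is_derive _ _ _ (cst 0)).
    near=> s; rewrite /pospart2 max_l ?expr0n//.
    by apply: ltW; near: s; exact: lt_nbhsl.
- apply: (@near_eq_is_derive _ _ _ (fun s => s ^+ 2)).
    near=> s; rewrite /pospart2 max_r//.
    by apply: ltW; near: s; exact: lt_nbhsr.
  have := @is_derive_pow id 1 t 1 (is_derive_id t 1).
  by rewrite expr1 mulr1.
(* At the corner, the slope of the chord from [0] to [s] is [Num.max 0 s], which is continuous. *)
- apply/is_derive1_caratheodory; exists (fun s => Num.max 0 s); split.
  + move=> z; rewrite /pospart2 maxxx expr0n/= subr0 subr0.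
    by have [z0|z0] := leP z 0; rewrite ?expr0n ?mul0r// expr2.
  + exact: continuous_pospart.
  + by rewrite maxxx mulr0.
Unshelve. all: by end_near. Qed.

Lemma pospart2_ge0 t : 0 <= pospart2 t. Proof. exact: sqr_ge0. Qed.

(* A C^1 nondecreasing step from 0 (for [s <= a]) to 1 (for [s >= b]). *)
Definition C1_step a b s : R :=
  pospart2 (1 - pospart2 (1 - (s - a) / (b - a))).

Definition C1_step' a b s : R :=
  4 / (b - a) * Num.max 0 (1 - pospart2 (1 - (s - a) / (b - a)))
  * Num.max 0 (1 - (s - a) / (b - a)).

Lemma is_derive_C1_step a b s : a < b -> is_derive s 1 (C1_step a b) (C1_step'
  a b s).
Proof.
rewrite -subr_gt0 => ab.
have d1 : is_derive s 1 (fun s => 1 - (s - a) / (b - a)) (- (b - a)^-1).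
  have h1 : is_derive s (1 : R) (fun s => s - a) (1 - 0) by exact: is_deriveB.
  apply: (@is_derive_eq _ _ _ _ s 1 _ _ (is_deriveB (is_derive_cst (1 : R) s 1)
    (is_derive_mul h1 (is_derive_cst ((b - a)^-1) s 1)))).
  by rewrite mulr0 addr0 subr0 mul1r sub0r.
have d2 := @is_derive1_comp R pospart2 (fun s => 1 - (s - a) / (b - a)) s _ _
  (is_derive_pospart2 _) d1.
have d3 := is_deriveB (is_derive_cst (1 : R) s 1) d2.
have d4 := @is_derive1_comp R pospart2 (fun s => 1 - pospart2 (1 - (s - a) / (b
  - a)))
  s _ _ (is_derive_pospart2 _) d3.
apply: (@is_derive_eq _ _ _ (C1_step a b) s 1 _ _ d4).
by rewrite /C1_step'; ring.
Qed.

Lemma continuous_C1_step' a b : continuous (C1_step' a b).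
Proof.
move=> s.
have c1 : {for s, continuous (fun s => 1 - (s - a) / (b - a))}.
  apply: cvgB; first exact: cvg_cst.
  by apply: cvgM; [apply: cvgB; [exact: cvg_id|exact: cvg_cst]|exact: cvg_cst].
apply: cvgM.
  apply: cvgM; first exact: cvg_cst.
  apply: (@continuous_comp _ _ _ (fun s => 1 - pospart2 (1 - (s - a) / (b - a)))
    (Num.max 0)); last exact: continuous_pospart.
  apply: cvgB; first exact: cvg_cst.
  apply: (@continuous_comp _ _ _ (fun s => 1 - (s - a) / (b - a)) pospart2) => //.
  exact: is_derive_continuous (is_derive_pospart2 _).
apply: (@continuous_comp _ _ _ (fun s => 1 - (s - a) / (b - a)) (Num.max 0)) => //.
exact: continuous_pospart.
Qed.

Lemma C1_step'_ge0 a b s : a < b -> 0 <= C1_step' a b s.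
Proof.
by rewrite -subr_gt0 => ab; rewrite !mulr_ge0 ?invr_ge0 ?le_max ?lexx// ltW.
Qed.

Lemma C1_step_ge0 a b s : 0 <= C1_step a b s. Proof. exact: pospart2_ge0. Qed.

Lemma C1_step_le1 a b s : C1_step a b s <= 1.
Proof.
rewrite /C1_step {1}/pospart2 expr_le1// ?le_max ?lexx// ge_max ler01.
by rewrite gerBl pospart2_ge0.
Qed.

Lemma C1_step_left a b s : a < b -> s <= a -> C1_step a b s = 0.
Proof.
rewrite -subr_gt0 => ab sa.
have h : (s - a) / (b - a) <= 0 by rewrite pmulr_lle0 ?invr_gt0// subr_le0.
(* For [s <= a] the inner square is at least 1, so the outer positive part is 0. *)
rewrite /C1_step {1}/pospart2 max_l ?expr0n// subr_le0 /pospart2 max_r; last by lra.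
by rewrite expr_ge1//; lra.
Qed.

Lemma C1_step'_left a b s : a < b -> s <= a -> C1_step' a b s = 0.
Proof.
rewrite -subr_gt0 => ab sa.
have h : (s - a) / (b - a) <= 0 by rewrite pmulr_lle0 ?invr_gt0// subr_le0.
rewrite /C1_step' max_l ?mulr0 ?mul0r// subr_le0 /pospart2 max_r; last by lra.
by rewrite expr_ge1//; lra.
Qed.

Lemma C1_step_right a b s : a < b -> b <= s -> C1_step a b s = 1.
Proof.
move=> ab bs; have ab0 : 0 < b - a by rewrite subr_gt0.
have h : 1 <= (s - a) / (b - a) by rewrite ler_pdivlMr// mul1r lerB.
rewrite /C1_step {2}/pospart2 max_l; last by rewrite subr_le0.
by rewrite expr0n/= subr0 /pospart2 max_r// expr1n.
Qed.

End real_calculus.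

(** * The ground state and the weight in the ball model *)

Section radial.
Context {R : realType}.
Implicit Types (s q : R).

Lemma artanh2_ge q : 0 <= q < 1 -> 2 * q <= artanh2 q.
Proof.
move=> /andP[q0 q1].
have h t : 0 <= t <= q -> is_derive t 1 (fun t => artanh2 t - 2 * t)
    (2 * 1 / (1 - t ^+ 2) - 2).
  move=> /andP[t0 tq]; have t1 : `|t| < 1 by rewrite ger0_norm// (le_lt_trans tq).
  apply: (@is_derive_eq _ _ _ _ t 1 _ _ (is_deriveB
    (@is_derive_artanh2 R id t 1 t1 (is_derive_id t 1))
    (is_derive_mul (is_derive_cst (2 : R) t 1) (is_derive_id t 1)))).
  by rewrite mul0r add0r mulr1.
have := is_derive_ge0_le q0 h; rewrite artanh20 mulr0 subr0 subr_ge0; apply.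
move=> t /andP[t0 tq]; have t1 : 0 < 1 - t ^+ 2 by nra.
by rewrite subr_ge0 ler_pdivlMr//; nra.
Qed.

(** This is [r <= sinh r] at [r = artanh2 q], in view of [sinh_artanh2]; it serves for the sign of
    the weight in dimension 2. *)
Lemma artanh2_le q : 0 <= q < 1 -> artanh2 q <= 2 * q / (1 - q ^+ 2).
Proof.
move=> /andP[q0 q1].
have h t : 0 <= t <= q -> is_derive t 1
    (fun t => 2 * t / (1 - t ^+ 2) - artanh2 t)
    (4 * t ^+ 2 / (1 - t ^+ 2) ^+ 2).
  move=> /andP[t0 tq]; have t1 : `|t| < 1 by rewrite ger0_norm// (le_lt_trans tq).
  have d0 : 1 - t ^+ 2 != 0 by rewrite gt_eqF//; nra.
  have d1 : is_derive t 1 (fun t : R => 1 - t ^+ 2) (0 - 2 * t ^+ 1 * 1).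
    exact: (is_deriveB (is_derive_cst (1 : R) t 1)
      (@is_derive_pow R id 1 t 1 (is_derive_id t 1))).
  apply: (@is_derive_eq _ _ _ _ t 1 _ _ (is_deriveB
    (is_derive_mul
      (is_derive_mul (is_derive_cst (2 : R) t 1) (is_derive_id t 1))
      (@is_derive_inv R (fun t => 1 - t ^+ 2) t _ d0 d1))
    (@is_derive_artanh2 R id t 1 t1 (is_derive_id t 1)))).
  by rewrite /=; field.
have := is_derive_ge0_le q0 h; rewrite artanh20 mulr0 mul0r subr0 subr_ge0; apply.
by move=> t _; apply: divr_ge0; rewrite ?sqr_ge0// mulr_ge0 ?sqr_ge0.
Qed.

Lemma sinh_artanh2 q : `|q| < 1 -> sinh (artanh2 q) = 2 * q / (1 - q ^+ 2).
Proof.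
rewrite ltr_norml => /andP[q1 q2].
have h1 : 0 < 1 + q by lra.
have h2 : 0 < 1 - q by lra.
rewrite /sinh -artanh2N /artanh2 opprK !expRB !lnK ?posrE//.
rewrite (_ : 1 - q ^+ 2 = (1 + q) * (1 - q)); last by ring.
by field; rewrite !gt_eqF.
Qed.

Variable k : nat.
Let m : R := k.+2%:R.

(* In terms of [s = |x|^2], in the ball model of curvature -1: [conf] is the
   conformal factor, [radius] the distance to the origin, and [field_coef s * x]
   the vector field [conf ^ (n - 2) * grad (log phi)] of the Euclidean metric,
   where [phi = r^(1/2) sinh(r)^(-(n-1)/2)] solves [- Delta phi = weight * phi]
   and [n = k + 2]. *)
Definition conf s : R := 2 / (1 - s).
Definition radius s : R := artanh2 (Num.sqrt s).

(** This is [(1/(2 r) - (n-1)/2 coth r) / sqrt s], the derivative of [log phi] in [r] divided by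
    [|x|], with [coth r = (1 + s) / (2 sqrt s)]. The exponent [k.+1 = n - 1] of [conf] in
    [field_coef] is [n - 2] plus one for [dr/d|x| = conf s]. *)
Definition field_q s : R :=
  (2 * (radius s * Num.sqrt s))^-1 - (m - 1) / 4 * ((1 + s) / s).
Definition field_q' s : R :=
  (m - 1) / (4 * s ^+ 2) - (conf s * Num.sqrt s + radius s)
    / (4 * (Num.sqrt s * (radius s * Num.sqrt s) ^+ 2)).

Definition field_coef s : R := conf s ^+ k.+1 * field_q s.
Definition field_coef' s : R :=
  k.+1%:R * conf s ^+ k.+2 / 2 * field_q s + conf s ^+ k.+1 * field_q' s.

(** The weight for [kappa = 1]: [s * conf s ^+ 2] is [sinh (radius s) ^+ 2]. *)
Definition weight1 s : R :=
  (m - 1) ^+ 2 / 4 + 1 / (4 * radius s ^+ 2)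
  + (m - 1) * (m - 3) / (4 * (s * conf s ^+ 2)).

Lemma sqrt_in01 s : 0 < s < 1 -> 0 < Num.sqrt s < 1.
Proof.
by move=> /andP[s0 s1]; rewrite sqrtr_gt0 s0/= -[ltRHS]sqrtr1 ltr_sqrt.
Qed.

Lemma radius_ge s : 0 < s < 1 -> 2 * Num.sqrt s <= radius s.
Proof.
by move=> /sqrt_in01 /andP[/ltW q0 q1]; apply: artanh2_ge; rewrite q0.
Qed.

Lemma radius_gt0 s : 0 < s < 1 -> 0 < radius s.
Proof.
move=> s01; apply: lt_le_trans (radius_ge s01).
by have /andP[q0 _] := sqrt_in01 s01; rewrite mulr_gt0.
Qed.

Lemma is_derive_radius s : 0 < s < 1 ->
  is_derive s 1 radius (conf s / (2 * Num.sqrt s)).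
Proof.
move=> s01; have /andP[s0 s1] := s01; have /andP[q0 q1] := sqrt_in01 s01.
have q01 : `|Num.sqrt s| < 1 by rewrite gtr0_norm.
apply: (@is_derive_eq _ _ _ _ s 1 _ _
  (@is_derive_artanh2 R Num.sqrt s _ q01 (is_derive1_sqrt s0))).
by rewrite sqr_sqrtr ?ltW// /conf; field; rewrite !gt_eqF//= subr_gt0.
Qed.

Lemma is_derive_conf s : s < 1 -> is_derive s 1 conf (conf s ^+ 2 / 2).
Proof.
move=> s1; have d0 : 1 - s != 0 by rewrite gt_eqF// subr_gt0.
have d1 : is_derive s (1 : R) (fun s => 1 - s) (0 - 1) by exact: is_deriveB.
apply: (@is_derive_eq _ _ _ _ s 1 _ _ (is_derive_mul (is_derive_cst (2 : R) s 1)
  (@is_derive_inv R (fun s => 1 - s) s _ d0 d1))).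
by rewrite /conf; field.
Qed.

Lemma is_derive_field_q s : 0 < s < 1 -> is_derive s 1 field_q (field_q' s).
Proof.
move=> s01; have /andP[s0 s1] := s01; have /andP[q0 q1] := sqrt_in01 s01.
have r0 := radius_gt0 s01.
have d0 : 2 * (radius s * Num.sqrt s) != 0 by rewrite gt_eqF// !mulr_gt0.
have dr := is_derive_radius s01.
have dA := @is_derive_inv R (fun s => 2 * (radius s * Num.sqrt s)) s _ d0
  (is_derive_mul (is_derive_cst (2 : R) s 1) (is_derive_mul dr (is_derive1_sqrt
    s0))).
have d1 : is_derive s (1 : R) (fun s => 1 + s) (0 + 1) by exact: is_deriveD.
have dB := is_derive_mul (is_derive_cst ((m - 1) / 4) s 1)
  (is_derive_mul d1 (is_derive_inv (lt0r_neq0 s0) (is_derive_id s 1))).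
apply: (@is_derive_eq _ _ _ _ s 1 _ _ (is_deriveB dA dB)).
rewrite /field_q'/=; field.
by rewrite !gt_eqF.
Qed.

Lemma is_derive_field_coef s : 0 < s < 1 ->
  is_derive s 1 field_coef (field_coef' s).
Proof.
move=> s01; have /andP[s0 s1] := s01.
apply: (@is_derive_eq _ _ _ _ s 1 _ _ (is_derive_mul
  (is_derive_pow k (is_derive_conf s1)) (is_derive_field_q s01))).
by rewrite /field_coef' (exprS _ k.+1) (exprS _ k); ring.
Qed.

Lemma continuous_field_coef' s : 0 < s < 1 -> {for s, continuous field_coef'}.
Proof.
move=> s01; have /andP[s0 s1] := s01; have /andP[q0 q1] := sqrt_in01 s01.
have r0 := radius_gt0 s01.
have c1 := is_derive_continuous (is_derive_conf s1).
have cq := is_derive_continuous (is_derive_field_q s01).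
have cr := is_derive_continuous (is_derive_radius s01).
have cs : {for s, continuous (fun s : R => Num.sqrt s)} by exact: sqrt_continuous.
have cp j : {for s, continuous (fun s => conf s ^+ j)}.
  by apply: (@continuous_comp _ _ _ conf (fun a : R => a ^+ j)) => //;
    exact: exprn_continuous.
have cq' : {for s, continuous field_q'}.
  apply: cvgB.
    apply: cvgM; first exact: cvg_cst.
    apply: cvgV; first by rewrite gt_eqF// mulr_gt0// exprn_gt0.
    by apply: cvgM; [exact: cvg_cst|exact: exprn_continuous].
  apply: cvgM; first by apply: cvgD => //; apply: cvgM.
  apply: cvgV; first by rewrite gt_eqF// !mulr_gt0// exprn_gt0// mulr_gt0.
  apply: cvgM; first exact: cvg_cst.
  apply: cvgM => //.
  apply: (@continuous_comp _ _ _ (fun s : R => radius s * Num.sqrt s) (fun a :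
    R => a ^+ 2)).
    by apply: cvgM.
  exact: exprn_continuous.
apply: cvgD; last by apply: cvgM => //; exact: cp.
apply: cvgM => //; apply: cvgM; last exact: cvg_cst.
by apply: cvgM; [exact: cvg_cst|exact: cp].
Qed.

Lemma continuous_weight1 s : 0 < s < 1 -> {for s, continuous weight1}.
Proof.
move=> s01; have /andP[s0 s1] := s01.
have r0 := radius_gt0 s01.
have cr := is_derive_continuous (is_derive_radius s01).
have c1 := is_derive_continuous (is_derive_conf s1).
have c0 : 0 < conf s by rewrite divr_gt0// subr_gt0.
apply: cvgD; first (apply: cvgD; first exact: cvg_cst).
  apply: cvgM; first exact: cvg_cst.
  apply: cvgV; first by rewrite gt_eqF// mulr_gt0// exprn_gt0.
  apply: cvgM; first exact: cvg_cst.
  by apply: (@continuous_comp _ _ _ radius (fun a : R => a ^+ 2)) => //;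
    exact: exprn_continuous.
apply: cvgM; first exact: cvg_cst.
apply: cvgV; first by rewrite gt_eqF// mulr_gt0// mulr_gt0// exprn_gt0.
apply: cvgM; first exact: cvg_cst.
apply: cvgM; first exact: cvg_id.
by apply: (@continuous_comp _ _ _ conf (fun a : R => a ^+ 2)) => //;
  exact: exprn_continuous.
Qed.

(* The radial form of [- Delta phi = weight * phi]. *)
Lemma field_coef_ode s : 0 < s < 1 ->
  m * field_coef s + 2 * s * field_coef' s + s * field_coef s ^+ 2 / conf s ^+ k
  = - weight1 s * conf s ^+ k.+2.
Proof.
move=> s01; have /andP[s0 s1] := s01; have /andP[q0 q1] := sqrt_in01 s01.
have r0 := radius_gt0 s01.
have c0 : 0 < conf s by rewrite divr_gt0// subr_gt0.
have ck : conf s ^+ k != 0 by rewrite gt_eqF// exprn_gt0.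
have d0 : 1 - s != 0 by rewrite gt_eqF// subr_gt0.
rewrite /field_coef /field_coef' /weight1 /field_q /field_q' !exprS.
have -> : k.+1%:R = m - 1 :> R by rewrite /m [in RHS]mulrSr addrK.
(* With [conf s ^+ k], [radius s] and [Num.sqrt s] taken as independent unknowns, a rational
   identity remains: all calculus is already contained in [field_coef']. *)
move: (conf s ^+ k) ck => c ck.
have sE : s = Num.sqrt s ^+ 2 by rewrite sqr_sqrtr// ltW.
rewrite /conf; move: (radius s) r0 => r r0.
move: (Num.sqrt s) q0 q1 sE => q q0 q1 sE; move: d0; rewrite sE => d0.
by field; rewrite d0 ck !gt_eqF.
Qed.

(** The decay of [sinh(r)^(-(n-1)/2)] beats the growth of [r^(1/2)]: as [radius s >= 2 sqrt s], the
    positive term of [field_q] is at most [1/(4 s)], and the subtracted one is at least that because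
    [m - 1 >= 1]. *)
Lemma field_coef_le0 s : 0 < s < 1 -> field_coef s <= 0.
Proof.
move=> s01; have /andP[s0 s1] := s01; have /andP[q0 q1] := sqrt_in01 s01.
have r0 := radius_gt0 s01; have rq := radius_ge s01.
have c0 : 0 < conf s by rewrite divr_gt0// subr_gt0.
rewrite /field_coef pmulr_rle0 ?exprn_gt0// subr_le0.
apply: (@le_trans _ _ (4 * s)^-1).
  rewrite lef_pV2 ?posrE ?mulr_gt0//.
  have := sqr_sqrtr (ltW s0); nra.
have m1 : 0 <= (k%:R : R) by [].
have -> : m - 1 = k%:R + 1 by rewrite /m -addn2 natrD; ring.
have v0 : 0 < s^-1 by rewrite invr_gt0.
have h : s^-1 <= (1 + s) / s by rewrite ler_peMl ?(ltW v0)//; lra.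
rewrite invfM; have := mulr_ge0 m1 (le_trans (ltW v0) h); lra.
Qed.

(** For [n = 2] the last coefficient is negative. Since [(m-1)(m-3) = k^2 - 1], the negative part is
    [1/(4 sinh(r)^2)], which [1/(4 r^2)] absorbs because [r <= sinh r]. *)
Lemma weight1_ge0 s : 0 < s < 1 -> 0 <= weight1 s.
Proof.
move=> s01; have /andP[s0 s1] := s01; have /andP[q0 q1] := sqrt_in01 s01.
have r0 := radius_gt0 s01.
have c0 : 0 < conf s by rewrite divr_gt0// subr_gt0.
have rS : radius s <= Num.sqrt s * conf s.
  have := @artanh2_le (Num.sqrt s);
    rewrite (ltW q0) q1 sqr_sqrtr ?(ltW s0)// => /(_ isT).
  by rewrite /conf /radius mulrA (mulrC _ 2).
have rS2 : radius s ^+ 2 <= s * conf s ^+ 2.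
  rewrite -[X in _ <= X * _](sqr_sqrtr (ltW s0)) -exprMn.
  by rewrite ler_pXn2r// nnegrE ltW// mulr_gt0.
have P1 : 0 < radius s ^+ 2 by exact: exprn_gt0.
have P2 : 0 < s * conf s ^+ 2 by rewrite mulr_gt0// exprn_gt0.
have V : (s * conf s ^+ 2)^-1 <= (radius s ^+ 2)^-1 by rewrite lef_pV2.
have V0 : 0 < (s * conf s ^+ 2)^-1 by rewrite invr_gt0.
have m0 : 0 <= (k%:R : R) by [].
rewrite /weight1 (invfM 4 (radius s ^+ 2)) (invfM 4 (s * _)).
have -> : m = k%:R + 2 by rewrite /m -addn2 natrD.
move: (s * _)^-1 (radius s ^+ 2)^-1 V V0 => v w V V0.
have h1 := mulr_ge0 m0 (ltW V0); have h2 := mulr_ge0 m0 h1.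
rewrite [leRHS](_ : _ =
  (k%:R + 1) ^+ 2 / 4 + (w - v) / 4 + k%:R * (k%:R * v) / 4); last first.
  by field.
by rewrite !addr_ge0// divr_ge0// ?sqr_ge0// subr_ge0.
Qed.

End radial.

(** * The weighted inequality in the ball *)

Section directional.
Context {R : realType}.

(** Restricting to the line [t |-> t *: w + x] reduces this to the one-variable chain rule, so that
    a directional derivative of [g] is enough. *)
Lemma is_derive_comp_dir (V : normedModType R) (f : R -> R) (g : V -> R) (x w :
  V) (df dg : R) :
  is_derive (g x) 1 f df -> is_derive x w g dg ->
  is_derive x w (f \o g) (df * dg).
Proof.
move=> Hf [dgx dgE].
pose phi (t : R) := t *: w + x.
have phi0 : phi 0 = x by rewrite /phi scale0r add0r.
have phiE (t : R) : phi (t *: 1 + 0) = t *: w + phi 0.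
  by rewrite phi0 addr0 [t *: 1]mulr1.
have d1 : is_derive (0 : R) 1 (g \o phi) dg.
  split; first exact: (derivable1P g x w).1.
  by rewrite (derive_line g phiE) phi0.
have d2 : is_derive (0 : R) 1 (f \o (g \o phi)) (df * dg).
  by apply: is_derive1_comp => //=; rewrite phi0.
split; first by apply/derivable1P; case: d2.
have := derive_line (f \o g) phiE; rewrite phi0 => <-.
by case: d2.
Qed.

Lemma is_derive_coord n (i j : 'I_n) (x : 'rV[R]_n) :
  is_derive x (delta_mx 0 i) (fun y : 'rV[R]_n => y 0 j) (i == j)%:R.
Proof.
pose phi (t : R) : 'rV[R]_n := t *: delta_mx 0 i + x.
have phi0 : phi 0 = x by rewrite /phi scale0r add0r.
have phiE (t : R) : phi (t *: 1 + 0) = t *: delta_mx 0 i + phi 0.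
  by rewrite phi0 addr0 [t *: 1]mulr1.
have d1 : is_derive (0 : R) 1 (fun t => phi t 0 j) (i == j)%:R.
  rewrite (_ : (fun t => _) = (fun t : R => t * (i == j)%:R + x 0 j)); last first.
    by apply/funext => t; rewrite !mxE eqxx/= eq_sym.
  have d2 := is_derive_mul (is_derive_id (0 : R) 1) (is_derive_cst ((i == j)%:R
    : R) (0 : R) 1).
  apply: (@is_derive_eq _ _ _ _ _ _ _ _ (is_deriveD d2 (is_derive_cst (x 0 j)
    (0 : R) 1))).
  by rewrite mul1r mulr0 !addr0.
split; first by apply/derivable1P; case: d1.
have := derive_line (fun y : 'rV[R]_n => y 0 j) phiE; rewrite phi0 => <-.
by case: d1.
Qed.

Lemma is_derive_sqnorm n (i : 'I_n) (x : 'rV[R]_n) :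
  is_derive x (delta_mx 0 i) sqnorm (2 * x 0 i).
Proof.
have h j : is_derive x (delta_mx 0 i) (fun y : 'rV[R]_n => y 0 j ^+ 2)
    ((i == j)%:R * x 0 j + x 0 j * (i == j)%:R).
  exact: (is_derive_mul (is_derive_coord i j x) (is_derive_coord i j x)).
have := is_derive_sum h; rewrite fct_sumE => H.
apply: (is_derive_eq H).
rewrite (bigD1 i)//= eqxx big1 ?addr0 /=; first by rewrite mul1r mulr1; ring.
by move=> j ji; rewrite eq_sym (negbTE ji) mul0r mulr0 addr0.
Qed.

End directional.

Section weighted_inequality.
Context {R : realType} {k : nat}.
Let n := k.+2.
Variables (v : 'rV[R]_n -> R) (K : set 'rV[R]_n).
Hypothesis cv : continuous v.
Hypothesis dv : forall i x, derivable v x (delta_mx 0 i).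
Hypothesis cdv : forall i, continuous (partial i v).
Hypothesis closedK : closed K.
Hypothesis K_lt1 : forall x, K x -> sqnorm x < 1.
Hypothesis v0 : forall x, ~ K x -> v x = 0.

Lemma near_v0 x : ~ K x -> \forall y \near x, v y = 0.
Proof.
move=> Kx; have : nbhs x (~` K) by apply: open_nbhs_nbhs; split => //;
  exact: closed_openC.
by apply: filterS => y; exact: v0.
Qed.

Lemma near_notK x : ~ K x -> \forall y \near x, ~ K y.
Proof.
by move=> Kx; apply: open_nbhs_nbhs; split => //; exact: closed_openC.
Qed.

Lemma partial0 i x : ~ K x -> partial i v x = 0.
Proof.
move=> Kx; rewrite /partial -(derive_cst (0 : R) x (delta_mx 0 i)).
exact: near_eq_derive (near_v0 Kx).
Qed.

(** As [K] is closed, [f] is zero near each point off [K]; as [K] lies in the open ball, formulas in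
    [conf] need to be examined only where [conf] is regular. *)
Lemma continuous_near0 (f : 'rV[R]_n -> R) x :
  (forall y, ~ K y -> f y = 0) -> (sqnorm x < 1 -> {for x, continuous f}) ->
  {for x, continuous f}.
Proof.
move=> f0 cf; have [/K_lt1 //|Kx] := pselect (K x).
apply: (near_cst_continuous 0); have := near_notK Kx.
by apply: filterS => y; exact: f0.
Qed.

Lemma bounded_support0 (f : 'rV[R]_n -> R) :
  (forall y, ~ K y -> f y = 0) -> bounded_support f.
Proof.
move=> f0; exists 1 => x i x1; apply: f0 => /K_lt1; apply/negP; rewrite -leNgt.
rewrite /sqnorm (bigD1 i)//= ler_wpDr ?sumr_ge0// => [j _|]; first exact: sqr_ge0.
by rewrite -real_normK ?num_real// expr_ge1// ltW.
Qed.

Section radial_field.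
Variables (H H' : R -> R).
Hypothesis dH : forall s : R, s < 1 -> is_derive s 1 H (H' s).
Hypothesis cH' : forall s : R, s < 1 -> {for s, continuous H'}.

(** Component of the field [H(|x|^2) v^2 x]. [H] will be [field_coef] times a cutoff, hence C^1
    across [s = 0], where [field_coef] is singular. *)
Definition radial_field (i : 'I_n) (x : 'rV[R]_n) : R :=
  H (sqnorm x) * (x 0 i * v x ^+ 2).

Definition radial_field' (i : 'I_n) (x : 'rV[R]_n) : R :=
  H' (sqnorm x) * (2 * x 0 i) * (x 0 i * v x ^+ 2)
  + H (sqnorm x) * (v x ^+ 2 + x 0 i * (2 * v x * partial i v x)).

Lemma is_derive_radial_field i x :
  is_derive x (delta_mx 0 i) (radial_field i) (radial_field' i x).
Proof.
have [/K_lt1 x1|Kx] := pselect (K x); last first.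
  rewrite /radial_field' v0// partial0// expr0n/= !mulr0 addr0 mulr0 addr0.
  apply: (@near_eq_is_derive _ _ _ (cst 0)).
  by apply: filterS (near_v0 Kx) => y vy; rewrite /radial_field vy expr0n/= !mulr0.
have h1 := is_derive_comp_dir (dH x1) (is_derive_sqnorm i x).
have dvx : is_derive x (delta_mx 0 i) v (partial i v x) by exact: derivableP.
have h2 := is_derive_mul (is_derive_coord i i x) (is_derive_mul dvx dvx).
apply: (@is_derive_eq _ _ _ (radial_field i) _ _ _ _ (is_derive_mul h1 h2)).
by rewrite eqxx /radial_field'/=; ring.
Qed.

Lemma radial_field'0 i x : ~ K x -> radial_field' i x = 0.
Proof.
by move=> Kx; rewrite /radial_field' v0// expr0n/= !mulr0 !mul0r mulr0 addr0
  mulr0 addr0.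
Qed.

Lemma continuous_radial_field' i : continuous (radial_field' i).
Proof.
move=> x; apply: continuous_near0 => [y|x1]; first exact: radial_field'0.
have cs := @continuous_sqnorm R n x.
have ci : {for x, continuous (fun y : 'rV[R]_n => y 0 i)} by exact:
  coord_continuous.
have cHs : {for x, continuous (H \o sqnorm)}.
  by apply: continuous_comp => //; exact: is_derive_continuous (dH x1).
have cH's : {for x, continuous (H' \o sqnorm)}.
  by apply: continuous_comp => //; exact: cH'.
have cM (f g : 'rV[R]_n -> R) : {for x, continuous f} -> {for x, continuous g} ->
  {for x, continuous (fun y => f y * g y)} by move=> cf cg;
    apply: (@cvgM _ _ (nbhs x)).
have cD (f g : 'rV[R]_n -> R) : {for x, continuous f} -> {for x, continuous g} ->
  {for x, continuous (fun y => f y + g y)} by move=> cf cg;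
    apply: (@cvgD _ _ _ (nbhs x)).
have cC (a : R) : {for x, continuous (fun _ : 'rV[R]_n => a)} by exact:
  (@cvg_cst _ a _ (nbhs x)).
have cvx := @cv x; have cdvx := @cdv i x.
apply: (cD _ _ _ _).
  by apply: (cM _ _ (cM _ _ cH's (cM _ _ (cC 2) ci)) (cM _ _ ci (cM _ _ cvx cvx))).
exact: (cM _ _ cHs (cD _ _ (cM _ _ cvx cvx) (cM _ _ ci (cM _ _ (cM _ _ (cC 2)
  cvx) cdvx)))).
Qed.

Lemma integral_radial_field' i :
  (\int[lebesgue_rV n]_x (radial_field' i x)%:E = 0)%E.
Proof.
have E : partial i (radial_field i) = radial_field' i.
  by apply/funext => x; apply: derive_val; exact: is_derive_radial_field.
rewrite -E; apply: integral_partial_eq0.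
- by move=> x; case: (is_derive_radial_field i x).
- by rewrite E; exact: continuous_radial_field'.
- by apply: bounded_support0 => x Kx; rewrite /radial_field v0// expr0n/= !mulr0.
Qed.

End radial_field.


(** Densities for curvature -1: the volume contributes [conf ^ n] and the squared gradient
    [conf ^ (-2)], whence the exponent [k = n - 2] here and [k.+2 = n] in [potential]. *)
Definition energy (x : 'rV[R]_n) : R :=
  conf (sqnorm x) ^+ k * \sum_i partial i v x ^+ 2.

Definition potential (x : 'rV[R]_n) : R :=
  weight1 k (sqnorm x) * conf (sqnorm x) ^+ k.+2 * v x ^+ 2.

Lemma energy_ge0 x : 0 <= energy x.
Proof.
have [/K_lt1 x1|Kx] := pselect (K x); last first.
  by rewrite /energy big1 ?mulr0// => i _; rewrite partial0// expr0n.
rewrite mulr_ge0 ?sumr_ge0// => [|i _]; last exact: sqr_ge0.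
by rewrite exprn_ge0// divr_ge0// subr_ge0 ltW.
Qed.

Lemma energy0 x : ~ K x -> energy x = 0.
Proof.
by move=> Kx; rewrite /energy big1 ?mulr0// => i _; rewrite partial0// expr0n.
Qed.

Lemma continuous_energy : continuous energy.
Proof.
move=> x; apply: continuous_near0 => [y|x1]; first exact: energy0.
apply: (@cvgM _ _ (nbhs x)).
  apply: (@continuous_comp _ _ _ sqnorm (fun s : R => conf s ^+ k)).
    exact: continuous_sqnorm.
  apply: (@continuous_comp _ _ _ conf (fun a : R => a ^+ k));
    last exact: exprn_continuous.
  exact: is_derive_continuous (is_derive_conf x1).
apply: continuous_sum => i.
apply: (@continuous_comp _ _ _ (partial i v) (fun a : R => a ^+ 2));
  first exact: cdv.
exact: exprn_continuous.
Qed.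

Lemma potential_ge0 x : 0 < sqnorm x < 1 -> 0 <= potential x.
Proof.
move=> /[dup] x01 /andP[_ x1]; rewrite mulr_ge0 ?sqr_ge0// mulr_ge0 ?weight1_ge0//.
by rewrite exprn_ge0// divr_ge0// subr_ge0 ltW.
Qed.

Lemma open_punctured_ball : open [set x : 'rV[R]_n | 0 < sqnorm x < 1].
Proof.
have -> : [set x : 'rV[R]_n | 0 < sqnorm x < 1] = sqnorm @^-1` `]0, 1[%classic.
  by apply/seteqP; split => x /=; rewrite in_itv.
by apply: open_comp => [x _|]; [exact: continuous_sqnorm|exact: interval_open].
Qed.

Lemma measurable_potential :
  measurable_fun [set x : 'rV[R]_n | 0 < sqnorm x < 1] potential.
Proof.
apply: open_continuous_measurable_fun_rV; first exact: open_punctured_ball.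
move=> x /= x01; have /andP[x0 x1] := x01.
apply: (@cvgM _ _ (nbhs x)).
  apply: (@continuous_comp _ _ _ sqnorm (fun s : R => weight1 k s * conf s ^+
    k.+2)).
    exact: continuous_sqnorm.
  apply: cvgM; first exact: continuous_weight1.
  apply: (@continuous_comp _ _ _ conf (fun a : R => a ^+ k.+2));
    last exact: exprn_continuous.
  exact: is_derive_continuous (is_derive_conf x1).
by apply: (@continuous_comp _ _ _ v (fun a : R => a ^+ 2));
  [exact: cv|exact: exprn_continuous].
Qed.

(** * The inequality with a cutoff *)

Section cutoff.
Variables a b : R.
Hypotheses (a0 : 0 < a) (ab : a < b).

Let H s : R := C1_step a b s * field_coef k s.
Let H' s : R := C1_step' a b s * field_coef k s + C1_step a b s * field_coef' k s.

Let dH (s : R) : s < 1 -> is_derive s 1 H (H' s).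
Proof.
move=> s1; have [s0|s0] := ltP 0 s.
  by apply: is_derive_mul; [exact: is_derive_C1_step|apply:
    is_derive_field_coef; rewrite s0].
(* The step vanishes on a neighbourhood of every [s <= 0], because [0 < a]. *)
have sa : s < a by exact: le_lt_trans a0.
rewrite /H' C1_step'_left// ?(ltW sa)// C1_step_left// ?(ltW sa)// !mul0r addr0.
apply: (@near_eq_is_derive _ _ _ (cst 0)).
near=> t; rewrite /H C1_step_left ?mul0r//.
by apply: ltW; near: t; exact: lt_nbhsl.
Unshelve. all: by end_near. Qed.

Let cH' (s : R) : s < 1 -> {for s, continuous H'}.
Proof.
move=> s1; have [s0|s0] := ltP 0 s.
  have s01 : 0 < s < 1 by rewrite s0.
  apply: cvgD; apply: cvgM.
  - exact: continuous_C1_step'.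
  - exact: is_derive_continuous (is_derive_field_coef k s01).
  - exact: is_derive_continuous (is_derive_C1_step s ab).
  - exact: continuous_field_coef'.
have sa : s < a by exact: le_lt_trans a0.
apply: (near_cst_continuous 0); near=> t.
have ta : t <= a by apply: ltW; near: t; exact: lt_nbhsl.
by rewrite /H' C1_step'_left// C1_step_left// !mul0r addr0.
Unshelve. all: by end_near. Qed.

(** The right side minus the divergence is the step times a completed square, plus
    [- 2 s C1_step' field_coef v^2]. The latter is nonnegative because the step increases and
    [field_coef <= 0]; all other terms cancel by [field_coef_ode]. *)
Lemma sum_radial_field'_le x : 0 < sqnorm x < 1 ->
  \sum_i radial_field' H H' i x
  <= C1_step a b (sqnorm x) * (energy x - potential x).
Proof.
move=> x01; have /andP[x0 x1] := x01.
set s := sqnorm x; set P := \sum_i x 0 i * partial i v x.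
have c0 : 0 < conf s ^+ k by rewrite exprn_gt0// divr_gt0// subr_gt0.
have -> : \sum_i radial_field' H H' i x =
    2 * s * H' s * v x ^+ 2 + H s * (k.+2%:R * v x ^+ 2 + 2 * v x * P).
  rewrite /radial_field' -/s /P.
  transitivity (\sum_i (2 * H' s * v x ^+ 2 * x 0 i ^+ 2
      + (H s * v x ^+ 2 + H s * (2 * v x) * (x 0 i * partial i v x)))).
    by apply: eq_bigr => i _; ring.
  rewrite big_split/= -mulr_sumr big_split/= -mulr_sumr sumr_const card_ord.
  by rewrite -mulr_sumr -/(sqnorm x) -/s -[_ *+ n]mulr_natr /n; ring.
(* The square of [grad v - v grad (log phi)]: [field_coef k s * x 0 i / conf s ^+ k] is the [i]-th
   partial derivative of [log phi]. *)
have sq : 0 <= conf s ^+ k * \sum_i (partial i v x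
    - field_coef k s * v x * x 0 i / conf s ^+ k) ^+ 2.
  by rewrite mulr_ge0 ?sumr_ge0// => [|i _]; [exact: ltW|exact: sqr_ge0].
have {sq} : 0 <= energy x - 2 * field_coef k s * v x * P
    + s * field_coef k s ^+ 2 / conf s ^+ k * v x ^+ 2.
  apply: (le_trans sq); rewrite le_eqVlt; apply/orP; left; apply/eqP.
  transitivity (conf s ^+ k * \sum_i (partial i v x ^+ 2
      + (- (2 * field_coef k s * v x / conf s ^+ k) * (x 0 i * partial i v x)
      + (field_coef k s * v x / conf s ^+ k) ^+ 2 * x 0 i ^+ 2))).
    by congr (_ * _); apply: eq_bigr => i _; field; rewrite gt_eqF.
  rewrite !big_split/= -!mulr_sumr -/P -/(sqnorm x) -/s /energy -/s.
  by field; rewrite gt_eqF.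
move=> sq.
have /= ode := congr1 (fun z => z * v x ^+ 2) (field_coef_ode k x01).
have st0 := C1_step_ge0 a b s.
have := mulr_ge0 st0 sq.
have : 0 <= - (2 * s * C1_step' a b s * field_coef k s * v x ^+ 2).
  rewrite -mulNr mulr_ge0 ?sqr_ge0// -mulrN mulr_ge0 ?oppr_ge0 ?field_coef_le0//.
  by apply: mulr_ge0; [rewrite mulr_ge0// ltW|exact: C1_step'_ge0].
move=> h1 h2; rewrite /H /H' -subr_ge0.
have -> : C1_step a b s * (energy x - potential x) -
    (2 * s * (C1_step' a b s * field_coef k s + C1_step a b s * field_coef' k
      s) * v x ^+ 2 +
    C1_step a b s * field_coef k s * (k.+2%:R * v x ^+ 2 + 2 * v x * P)) =
  C1_step a b s * (energy x - 2 * field_coef k s * v x * P +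
    s * field_coef k s ^+ 2 / conf s ^+ k * v x ^+ 2)
  - 2 * s * C1_step' a b s * field_coef k s * v x ^+ 2
  - C1_step a b s * (((k.+2%:R * field_coef k s + 2 * s * field_coef' k s
      + s * field_coef k s ^+ 2 / conf s ^+ k) * v x ^+ 2) + potential x).
  by ring.
rewrite ode /potential -/s.
by rewrite !mulNr addNr mulr0 subr0 addr_ge0.
Qed.

Lemma integrable_step_energy :
  (lebesgue_rV n).-integrable setT
    (fun x => (C1_step a b (sqnorm x) * energy x)%:E).
Proof.
apply: (@bounded_support_integrable R n (fun x => C1_step a b (sqnorm x) *
  energy x)).
  move=> x; apply: (@cvgM _ _ (nbhs x)); last exact: continuous_energy.
  apply: (@continuous_comp _ _ _ sqnorm (C1_step a b));
    first exact: continuous_sqnorm.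
  exact: is_derive_continuous (is_derive_C1_step _ ab).
by apply: bounded_support0 => x Kx; rewrite energy0// mulr0.
Qed.

Lemma measurable_annulus : measurable [set x : 'rV[R]_n | b <= sqnorm x < 1].
Proof.
have := @continuous_measurable_fun_rV R n sqnorm (@continuous_sqnorm R n).
move=> /(_ measurableT `[b, 1[%classic); rewrite setTI.
rewrite (_ : sqnorm @^-1` _ = [set x : 'rV[R]_n | b <= sqnorm x < 1]).
  by apply; exact: measurable_itv.
by apply/seteqP; split => x /=; rewrite in_itv.
Qed.

(** The divergence has integral 0, so it may be subtracted on the right, and a pointwise comparison
    remains. Where [|x|^2 >= b] the step is 1; where [|x|^2 < b] the potential is dropped, being
    nonnegative. *)
Lemma potential_le_step_energy :
  (\int[lebesgue_rV n]_(x in [set x | (b <= sqnorm x < 1)%R]) (potential x)%:E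
  <= \int[lebesgue_rV n]_x (C1_step a b (sqnorm x) * energy x)%:E)%E.
Proof.
set D := [set x | _].
have D01 : D `<=` [set x : 'rV[R]_n | 0 < sqnorm x < 1].
  by move=> x /= /andP[bx x1]; rewrite x1 andbT (lt_le_trans _ bx)// (lt_trans a0).
have intF i : (lebesgue_rV n).-integrable setT (fun x => (radial_field' H H' i
  x)%:E).
  apply: (@bounded_support_integrable R n (radial_field' H H' i)).
    exact: continuous_radial_field'.
  by apply: bounded_support0 => x; exact: radial_field'0.
have intS : (lebesgue_rV n).-integrable setT
    (fun x => (\sum_i (radial_field' H H' i x)%:E)%E).
  exact: integrable_sum.
have S0 : (\int[lebesgue_rV n]_x (\sum_i (radial_field' H H' i x)%:E) = 0)%E.
  rewrite integral_sum//; apply: big1 => i _.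
  exact: integral_radial_field'.
rewrite -[leRHS]sube0 -S0 -integralB//; last exact: integrable_step_energy.
rewrite [leLHS]integral_mkcond.
apply: (@ge0_le_integral _ _ _ (lebesgue_rV n) setT measurableT).
- move=> x _; apply: erestrict_ge0 => y Dy; rewrite lee_fin potential_ge0//.
  exact: D01.
- apply/(measurable_restrictT _ measurable_annulus).
  by apply/measurable_EFinP; apply: measurable_funS measurable_potential;
    [exact: open_measurable_rV open_punctured_ball|].
- apply: emeasurable_funB; first exact: measurable_int integrable_step_energy.
  exact: measurable_int intS.
move=> x _; rewrite patchE/= sumEFin -EFinB.
(* Off the punctured ball the right side is 0: the point is either outside [K] or the origin, where
   the step vanishes. *)
have [xp|xn] := boolP (0 < sqnorm x < 1); last first.
  have xD : x \in D = false.
    by apply/negbTE; apply: contra xn; rewrite inE => /D01.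
  rewrite xD lee_fin subr_ge0.
  have [/K_lt1 x1|Kx] := pselect (K x); last first.
    by rewrite energy0// mulr0 big1// => i _; rewrite radial_field'0.
  have xa : sqnorm x <= a.
    by apply: le_trans (ltW a0); rewrite leNgt; apply: contra xn => ->.
  rewrite C1_step_left// mul0r big1// => i _.
  by rewrite /radial_field' /H /H' C1_step'_left// C1_step_left// !(mul0r, addr0).
have := sum_radial_field'_le xp; case: ifPn => [|_].
  rewrite inE => /andP[bx x1]; rewrite C1_step_right// !mul1r lee_fin; lra.
rewrite lee_fin => h; rewrite subr_ge0; apply: (le_trans h).
by rewrite ler_wpM2l ?C1_step_ge0// gerBl potential_ge0.
Qed.

End cutoff.

(** * Removal of the cutoff *)

Lemma integrable_energy : (lebesgue_rV n).-integrable setT (fun x => (energy x)%:E).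
Proof.
apply: (@bounded_support_integrable R n energy); first exact: continuous_energy.
by apply: bounded_support0 => x; exact: energy0.
Qed.

(** The upper end of the steps stays at [b] while the lower end increases to [b]. Each step is 1 at
    [b] itself, so the limit is the indicator of [|x|^2 >= b], the exterior of an open ball; the
    energy dominates. *)
Lemma potential_le_energy b : 0 < b ->
  (\int[lebesgue_rV n]_(x in [set x | (b <= sqnorm x < 1)%R]) (potential x)%:E
  <= \int[lebesgue_rV n]_(x in [set x | (b <= sqnorm x < 1)%R]) (energy x)%:E)%E.
Proof.
move=> b0; set D := [set x | _].
(* The shift [j.+2] keeps [a_ 0 = b / 2] positive. *)
pose a_ (j : nat) : R := b - b * j.+2%:R^-1.
have j0 (j : nat) : 0 < j.+2%:R^-1 :> R by rewrite invr_gt0.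
have j1 (j : nat) : j.+2%:R^-1 < 1 :> R by rewrite invf_lt1// ltr1n.
have a0 j : 0 < a_ j by rewrite /a_ subr_gt0 gtr_pMr.
have ab j : a_ j < b by rewrite /a_ gtrBl mulr_gt0.
have mD : measurable D by exact: measurable_annulus.
have menergy : measurable_fun setT (fun x => (energy x)%:E).
  exact: measurable_int integrable_energy.
pose f_ j x := (C1_step (a_ j) b (sqnorm x) * energy x)%:E.
have [||||_ _] := @dominated_convergence _ _ _ (lebesgue_rV n) setT measurableT f_
    ((fun x => (energy x)%:E) \_ D) (fun x => (energy x)%:E) _ _ _
      integrable_energy _.
- by move=> j; exact: measurable_int (integrable_step_energy (ab j)).
- by apply/(measurable_restrictT _ mD); exact: measurable_funTS.
- apply: aeW => x _; rewrite patchE.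
  case: ifPn => [|].
    rewrite inE => /andP[bx _].
    rewrite (_ : f_ ^~ x = cst (energy x)%:E); first exact: cvg_cst.
    by apply/funext => j; rewrite /f_ C1_step_right// mul1r.
  rewrite notin_setE /D/= => /negP; rewrite negb_and -ltNge -leNgt.
  case: (ltP (sqnorm x) 1) => [x1|x1 _]; last first.
    rewrite (_ : f_ ^~ x = cst 0%E); first exact: cvg_cst.
    by apply/funext => j; rewrite /f_ energy0 ?mulr0// => /K_lt1; rewrite ltNge x1.
  rewrite orbF => xb.
  have e0 : 0 < (b - sqnorm x) / b by rewrite divr_gt0// subr_gt0.
  apply: cvg_near_cst; near=> j.
  rewrite /f_ C1_step_left ?mul0r//.
  rewrite /a_ lerBrDr -lerBrDl.
  rewrite mulrC -ler_pdivlMr//; apply: ltW.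
  apply: (@le_lt_trans _ _ j.+1%:R^-1).
    by rewrite lef_pV2 ?posrE// ler_nat.
  by near: j; exact: (near_infty_natSinv_lt (PosNum e0)).
- apply: aeW => x j _; rewrite /f_ /= lee_fin normrM !ger0_norm ?energy_ge0
  ?C1_step_ge0//.
  by rewrite ler_piMl ?energy_ge0// C1_step_le1.
- rewrite -integral_mkcond => f_cvg.
  apply: (cvge_ge _ f_cvg); apply: nearW => j.
  exact: (potential_le_step_energy (a0 j) (ab j)).
Unshelve. all: by end_near. Qed.

(** * From exterior domains to the whole ball *)

Lemma set1_rV0E :
  [set (0 : 'rV[R]_n)] = [set x | forall i, [set (0 : R)] (x 0 i)].
Proof.
apply/seteqP; split => [x -> i|x /= x0]; first by rewrite /= mxE.
by apply/rowP => i; rewrite mxE; exact: x0.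
Qed.

Lemma lebesgue_rV_set1 : (lebesgue_rV n) [set (0 : 'rV[R]_n)] = 0%E.
Proof.
rewrite set1_rV0E (lebesgue_rV_box (B := fun=> [set (0 : R)])) => [|i].
  by rewrite big_ord_recl lebesgue_measure_set1 mul0e.
exact: measurable_set1.
Qed.

Lemma sqnorm_eq0 (x : 'rV[R]_n) : (sqnorm x == 0) = (x == 0).
Proof.
apply/eqP/eqP => [x0|->]; last by rewrite /sqnorm big1// => i _; rewrite mxE expr0n.
apply/rowP => i; rewrite mxE; apply/eqP; rewrite -sqrf_eq0.
move/eqP : x0; rewrite psumr_eq0 => [/allP/(_ i)|j _]; last exact: sqr_ge0.
by rewrite mem_index_enum => /(_ isT).
Qed.

Lemma measurable_set1_rV0 : measurable [set (0 : 'rV[R]_n)].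
Proof.
rewrite set1_rV0E.
by apply: (@measurable_rV_forall _ _ (fun=> [set (0 : R)])) => i;
  exact: measurable_set1.
Qed.

Lemma hyp_space_punctured : hyp_space n `\` [set (0 : 'rV[R]_n)] =
  [set x : 'rV[R]_n | 0 < sqnorm x < 1].
Proof.
apply/seteqP; split => [x []|x /= /andP[x0 x1]].
  rewrite hyp_spaceE => x1 /eqP x0; apply/andP; split => //.
  by rewrite lt_neqAle sqnorm_ge0 eq_sym sqnorm_eq0 x0.
split; first by rewrite hyp_spaceE.
by apply/eqP; rewrite -sqnorm_eq0 gt_eqF.
Qed.

Lemma measurable_potentialT : measurable_fun (hyp_space n) potential.
Proof.
have -> : hyp_space n = [set x : 'rV[R]_n | 0 < sqnorm x < 1] `|` [set (0 :
  'rV[R]_n)].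
  rewrite -hyp_space_punctured setUC setDUK// => x ->; rewrite hyp_spaceE.
  by have /eqP -> : sqnorm (0 : 'rV[R]_n) == 0 by rewrite sqnorm_eq0.
apply/measurable_funU.
- exact: open_measurable_rV open_punctured_ball.
- exact: measurable_set1_rV0.
- by split; [exact: measurable_potential|exact: measurable_fun_set1].
Qed.

Lemma potential_ge0T x : sqnorm x < 1 -> 0 <= potential x.
Proof.
move=> x1; have [x0|x0] := eqVneq x 0; last first.
  by apply: potential_ge0; rewrite x1 lt_neqAle sqnorm_ge0 eq_sym sqnorm_eq0 x0.
have /eqP s0 : sqnorm x == 0 by rewrite sqnorm_eq0 x0.
rewrite /potential s0 mulr_ge0 ?sqr_ge0// mulr_ge0//.
  (* At the origin both singular terms have denominator 0, hence value 0, and [(m - 1)^2 / 4] is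
     left. *)
  rewrite /weight1 /radius sqrtr0 artanh20 expr0n/= mul0r !mulr0 invr0 !mulr0
    !addr0.
  by rewrite divr_ge0 ?sqr_ge0.
by rewrite exprn_ge0// divr_ge0// subr0.
Qed.

(** The annuli [F j] miss only the origin of the ball, a null set. On each of them the right side is
    enlarged to the full energy before monotone convergence is applied to the left. *)
Lemma potential_le_energyT :
  (\int[lebesgue_rV n]_(x in hyp_space n) (potential x)%:E
  <= \int[lebesgue_rV n]_(x in hyp_space n) (energy x)%:E)%E.
Proof.
pose D := [set x : 'rV[R]_n | 0 < sqnorm x < 1].
have mD : measurable D by exact: open_measurable_rV open_punctured_ball.
have mU : measurable (hyp_space n : set 'rV[R]_n).
  exact: open_measurable_rV open_hyp_space.
have UD : hyp_space n `\` [set (0 : 'rV[R]_n)] = D by exact: hyp_space_punctured.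
have mpot : measurable_fun D (fun x => (potential x)%:E).
  by apply/measurable_EFinP; exact: measurable_potential.
have DU : D `<=` hyp_space n by rewrite -UD => x [].
have menergy E : measurable E -> measurable_fun E (fun x => (energy x)%:E).
  by move=> mE; apply: measurable_funTS; exact: measurable_int integrable_energy.
have e0 x : (0 <= (energy x)%:E)%E by rewrite lee_fin energy_ge0.
have -> : (\int[lebesgue_rV n]_(x in hyp_space n) (potential x)%:E
    = \int[lebesgue_rV n]_(x in D) (potential x)%:E)%E.
  rewrite -UD; apply: ge0_negligible_integral => //.
  - exact: measurable_set1_rV0.
  - by apply/measurable_EFinP; exact: measurable_potentialT.
  - by move=> x; rewrite hyp_spaceE lee_fin; exact: potential_ge0T.
  - exact: lebesgue_rV_set1.
pose F (j : nat) := [set x : 'rV[R]_n | j.+1%:R^-1 <= sqnorm x < 1].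
have FD : \bigcup_j F j = D.
  apply/seteqP; split => [x [j _ /andP[x0 x1]]|x /= /andP[x0 x1]].
    by apply/andP; split => //; apply: lt_le_trans x0; rewrite invr_gt0.
  have [j _ /(_ _ (leqnn j))/= jx] := near_infty_natSinv_lt (PosNum x0).
  by exists j => //; apply/andP; split => //; exact: ltW.
have FjD j : F j `<=` D by rewrite -FD => x Fx; exists j.
have mF j : measurable (F j) by exact: measurable_annulus.
have ndF : nondecreasing_seq F.
  move=> i j ij; apply/subsetPset => x /andP[x0 x1]; apply/andP; split => //.
  by apply: le_trans x0; rewrite lef_pV2 ?posrE// ler_nat.
have := @ge0_nondecreasing_set_cvg_integral _ _ _ F (fun x => (potential x)%:E)
  (lebesgue_rV n) ndF mF.
rewrite FD => cvgF.
have p0 j x : F j x -> (0 <= (potential x)%:E)%E.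
  by move=> Fx; rewrite lee_fin potential_ge0//; exact: FjD Fx.
have mpotF j : measurable_fun (F j) (fun x => (potential x)%:E).
  exact: measurable_funS mD (FjD j) mpot.
apply: (cvge_le _ (cvgF mpotF p0)); exists 0%N => // j _ /=.
apply: le_trans (potential_le_energy _) _; first by rewrite invr_gt0.
exact: (@ge0_subset_integral _ _ _ (lebesgue_rV n) (F j) _ (mF j) mU _
  (menergy _ mU) (fun x _ => e0 x) (subset_trans (FjD j) DU)).
Qed.

End weighted_inequality.

(** * Hyperbolic integrals *)

Section translation.
Context {R : realType} {k : nat}.
Let n := k.+2.
Variables (kappa : R) (u : 'rV[R]_n -> R).
Hypothesis k0 : 0 < kappa.

Let sk0 : 0 < Num.sqrt kappa. Proof. by rewrite sqrtr_gt0. Qed.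

(* The constant relating the volume and energy densities for curvature [-kappa]
   to those for curvature [-1]. *)
Let c : R := kappa / Num.sqrt kappa ^+ n.

Let c_ge0 : 0 <= c.
Proof. by rewrite divr_ge0 ?exprn_ge0// ltW. Qed.

Lemma hyp_metricE (x : 'rV[R]_n) :
  hyp_metric kappa x = ((conf (sqnorm x) / Num.sqrt kappa) ^+ 2)%:M.
Proof.
rewrite /hyp_metric euclid_norm_sqr; congr (_%:M).
by rewrite /conf !exprMn !exprVn (sqr_sqrtr (ltW k0)) invfM; ring.
Qed.

Lemma sqrt_det_hyp (x : 'rV[R]_n) : sqnorm x < 1 ->
  Num.sqrt (\det (hyp_metric kappa x)) = (conf (sqnorm x) / Num.sqrt kappa) ^+ n.
Proof.
move=> x1; rewrite hyp_metricE det_scalar -exprM mulnC exprM sqrtr_sqr ger0_norm//.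
by rewrite exprn_ge0// !divr_ge0 ?subr_ge0// ltW.
Qed.

Lemma energy_density (x : 'rV[R]_n) : sqnorm x < 1 ->
  hyp_grad_norm kappa u x ^+ 2 * Num.sqrt (\det (hyp_metric kappa x))
  = c * energy u x.
Proof.
move=> x1; have cx : 0 < conf (sqnorm x) by rewrite divr_gt0 ?subr_gt0.
rewrite sqrt_det_hyp// /hyp_grad_norm /riem_norm /riem_grad /riem_dot hyp_metricE.
rewrite invmx_scalar mul_mx_scalar mul_mx_scalar.
set g := (conf _ / _) ^+ 2; set p := \row_i _.
have g0 : 0 < g by rewrite exprn_gt0// divr_gt0.
have -> : ((g *: (g^-1 *: p)) *m (g^-1 *: p)^T) 0 0 = g^-1 * \sum_i partial i u
  x ^+ 2.
  rewrite scalerA divff ?gt_eqF// scale1r mxE mulr_sumr.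
  by apply: eq_bigr => i _; rewrite !mxE; ring.
rewrite sqr_sqrtr; last by rewrite mulr_ge0 ?sumr_ge0 ?invr_ge0 ?(ltW g0)// =>
  i _; exact: sqr_ge0.
rewrite /energy /c /g -[X in _ = X / _ * _](sqr_sqrtr (ltW k0)).
have alg (C S T : R) : C != 0 -> S != 0 ->
    ((C / S) ^+ 2)^-1 * T * (C / S) ^+ n = S ^+ 2 / S ^+ n * (C ^+ k * T).
  move=> C0 S0; rewrite (expr_div_n _ _ n) /n !(exprS _ k.+1) !(exprS _ k).
  have : S ^+ k != 0 by rewrite expf_neq0.
  move: (C ^+ k) (S ^+ k) => Ck Sk Sk0; field.
  by rewrite Sk0 C0 S0.
by rewrite alg ?gt_eqF.
Qed.

(** At a given point of the ball, [sqrt kappa * r] does not depend on [kappa], so each of the three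
    terms is proportional to [kappa]. *)
Lemma weightE (x : 'rV[R]_n) : sqnorm x < 1 ->
  (n%:R - 1) ^+ 2 * kappa / 4 + 1 / (4 * hyp_r kappa x ^+ 2)
  + (n%:R - 1) * (n%:R - 3) * kappa
    / (4 * sinh (Num.sqrt kappa * hyp_r kappa x) ^+ 2)
  = kappa * weight1 k (sqnorm x).
Proof.
move=> x1; have xU : hyp_space n x by rewrite hyp_spaceE.
have e1 : `|euclid_norm x| < 1 by rewrite ger0_norm ?euclid_norm_ge0//; exact: xU.
have rE : hyp_r kappa x = radius (sqnorm x) / Num.sqrt kappa.
  by rewrite -[radius _](hyp_rE k0 xU) mulrAC divff ?mul1r// gt_eqF.
rewrite hyp_rE// sinh_artanh2// -mulrA mulrCA -/(euclid_norm x).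
rewrite euclid_norm_sqr rE exprMn exprVn (sqr_sqrtr (ltW k0)).
rewrite /weight1 -/n; have -> : (2 * euclid_norm x / (1 - sqnorm x)) ^+ 2 =
    sqnorm x * conf (sqnorm x) ^+ 2.
  by rewrite -(euclid_norm_sqr x) -exprMn /conf; congr (_ ^+ 2); ring.
rewrite !invfM invrK; ring.
Qed.

Lemma potential_density (x : 'rV[R]_n) : sqnorm x < 1 ->
  kappa * weight1 k (sqnorm x) * u x ^+ 2 * Num.sqrt (\det (hyp_metric kappa x))
  = c * potential u x.
Proof.
move=> x1; rewrite sqrt_det_hyp// /potential /c expr_div_n /n; ring.
Qed.

(** Since [artanh2 q] is twice [artanh q], the radius [rho] corresponds to
    [|x| = tanh (sqrt kappa * rho / 2)], which is [(E - 1) / (E + 1)]; [b] is its square. *)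
Lemma hyp_ball_complement (rho : R) : 0 < rho -> exists2 b : R, 0 < b &
  hyp_space n `\` hyp_ball n kappa rho = [set x | b <= sqnorm x < 1].
Proof.
move=> rho0; set E := expR (Num.sqrt kappa * rho).
have E1 : 1 < E by rewrite expR_gt1 mulr_gt0.
have q0 : 0 < (E - 1) / (E + 1) by rewrite divr_gt0 ?subr_gt0// addr_gt0//
  (lt_trans _ E1).
exists (((E - 1) / (E + 1)) ^+ 2); first by rewrite exprn_gt0.
have key (x : 'rV[R]_n) : sqnorm x < 1 ->
    (hyp_r kappa x < rho) = (sqnorm x < ((E - 1) / (E + 1)) ^+ 2).
  move=> x1; have xU : hyp_space n x by rewrite hyp_spaceE.
  have e1 : euclid_norm x < 1 by exact: xU.
  have e0 := euclid_norm_ge0 x.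
  rewrite -(ltr_pM2l sk0) hyp_rE// -euclid_norm_sqr ltr_pXn2r ?nnegrE ?(ltW q0)//.
  rewrite -ltr_expR /artanh2 expRB !lnK ?posrE; [|lra|lra].
  rewrite ltr_pdivrMr ?subr_gt0// ltr_pdivlMr; last by lra.
  rewrite -/E; apply/idP/idP; nra.
apply/seteqP; split => [x [xU nB]|x /= /andP[bx x1]].
  have x1 : sqnorm x < 1 by rewrite -hyp_spaceE.
  apply/andP; split => //; rewrite leNgt -key//; apply/negP => xr; apply: nB.
  by split.
split; first by rewrite hyp_spaceE.
by move=> [_]; rewrite -/(hyp_r kappa x) key// ltNge bx.
Qed.

Lemma hyp_integral_scale (D : set 'rV[R]_n) (f g : 'rV[R]_n -> R) :
  measurable D -> measurable_fun D g -> (forall x, D x -> 0 <= g x) ->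
  (forall x, D x -> f x * Num.sqrt (\det (hyp_metric kappa x)) = c * g x) ->
  (hyp_integral kappa D f = c%:E * \int[lebesgue_rV n]_(x in D) (g x)%:E)%E.
Proof.
move=> mD mg g0 fg; rewrite -ge0_integralZl_EFin//.
  by apply: eq_integral => x /set_mem/fg ->; rewrite EFinM.
exact/measurable_EFinP.
Qed.

End translation.

(** * Extension by zero *)

Section smooth_compact_support_extension.
Context {R : realType} {n : nat}.
Variable u : 'rV[R]_n -> R.
Hypothesis hu : smooth_compact_support (hyp_space n) u.

Let v x := if `[< hyp_space n x >] then u x else 0.

Let K_ex : exists K : set 'rV[R]_n,
  [/\ closed K, K `<=` hyp_space n & forall x, ~ K x -> v x = 0].
Proof.
have [_ [K [cK KU K0]]] := hu; exists K; split => //.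
  by apply: compact_closed => //; exact: norm_hausdorff.
by move=> x Kx; rewrite /v; case: asboolP => // xU; exact: K0.
Qed.

(** The values of [u] off the ball are arbitrary, so they are replaced by 0. The result is C^1 on
    R^n since every point lies either in the open ball, where [v] agrees with [u] nearby, or off
    [K], where [v] is 0 nearby. *)
Lemma smooth_compact_support_extension :
  exists (v : 'rV[R]_n -> R) (K : set 'rV[R]_n),
  [/\ forall x, hyp_space n x -> v x = u x,
      forall i x, hyp_space n x -> partial i v x = partial i u x,
      [/\ closed K, K `<=` hyp_space n & forall x, ~ K x -> v x = 0] &
      [/\ continuous v, forall i x, derivable v x (delta_mx 0 i) &
          forall i, continuous (partial i v)]].
Proof.
have [K [cK KU K0]] := K_ex; exists v, K.
have [su _] := hu.
have vu x : hyp_space n x -> v x = u x by move=> xU; rewrite /v asboolT.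
have near_vu x : hyp_space n x -> \forall y \near x, v y = u y.
  move=> xU; have : nbhs x (hyp_space n) by apply: open_nbhs_nbhs; split => //;
    exact: open_hyp_space.
  by apply: filterS => y; exact: vu.
have near_uv x : hyp_space n x -> \forall y \near x, u y = v y.
  by move=> /near_vu; apply: filterS => y ->.
have near_0 x : ~ K x -> \forall y \near x, ~ K y.
  by move=> Kx; apply: open_nbhs_nbhs; split => //; exact: closed_openC.
have near_v0 x : ~ K x -> \forall y \near x, (cst 0 : _ -> R) y = v y.
  by move=> /near_0; apply: filterS => y /K0 ->.
have pvu i x : hyp_space n x -> partial i v x = partial i u x.
  by move=> xU; apply: near_eq_derive; exact: near_vu.
have pv0 i x : ~ K x -> partial i v x = 0.
  by move=> Kx; rewrite -(derive_cst (0 : R) x (delta_mx 0 i));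
    apply/esym/near_eq_derive/near_v0.
split=> //; split.
- move=> x; have [/KU xU|Kx] := pselect (K x).
    rewrite /continuous_at vu//; apply: cvg_trans (su [::] x xU).1.
    exact: near_eq_cvg (near_uv _ xU).
  apply: (near_cst_continuous 0); apply: filterS (near_0 _ Kx) => y; exact: K0.
- move=> i x; have [/KU xU|Kx] := pselect (K x).
    by apply: (near_eq_derivable (near_uv _ xU)); exact: (su [::] x xU).2.
  by apply: (near_eq_derivable (near_v0 _ Kx)); exact: derivable_cst.
- move=> i x; have [/KU xU|Kx] := pselect (K x).
    rewrite /continuous_at pvu//; apply: cvg_trans (su [:: i] x xU).1.
    have near_puv : \forall y \near x, partial i u y = partial i v y.
      have : nbhs x (hyp_space n) by apply: open_nbhs_nbhs; split => //;
        exact: open_hyp_space.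
      by apply: filterS => y yU; rewrite pvu.
    exact: near_eq_cvg near_puv.
  apply: (near_cst_continuous 0); apply: filterS (near_0 _ Kx) => y; exact: pv0.
Qed.

End smooth_compact_support_extension.

Theorem theorem1p3 (R : realType) (n : nat) (kappa : R)
    (hn : (2 <= n)%N) (hkappa : 0 < kappa)
    (u : 'rV[R]_n -> R) (hu : smooth_compact_support (hyp_space n) u) :
  let weight (x : 'rV[R]_n) : R :=
    (n%:R - 1) ^+ 2 * kappa / 4
    + 1 / (4 * hyp_r kappa x ^+ 2)
    + (n%:R - 1) * (n%:R - 3) * kappa
      / (4 * sinh (Num.sqrt kappa * hyp_r kappa x) ^+ 2) in
  (forall rho : R, 0 < rho ->
    (hyp_integral kappa (hyp_space n `\` hyp_ball n kappa rho)
       (fun x => (hyp_grad_norm kappa u x ^+ 2)%R)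
     >= hyp_integral kappa (hyp_space n `\` hyp_ball n kappa rho)
       (fun x => (weight x * u x ^+ 2)%R))%E) /\
  (hyp_integral kappa (hyp_space n)
     (fun x => (hyp_grad_norm kappa u x ^+ 2)%R)
   >= hyp_integral kappa (hyp_space n)
     (fun x => (weight x * u x ^+ 2)%R))%E.
Proof.
case: n hn u hu => [|[|k]]// _ u hu weight.
have [v [K [vu pvu [cK KU v0] [cv dv cdv]]]] := smooth_compact_support_extension hu.
have K1 x : K x -> sqnorm x < 1 by move=> /KU; rewrite hyp_spaceE.
have eE x : hyp_space k.+2 x -> energy u x = energy v x.
  by move=> xU; rewrite /energy; congr (_ * _); apply: eq_bigr => i _; rewrite pvu.
have pE x : hyp_space k.+2 x -> potential u x = potential v x.
  by move=> xU; rewrite /potential vu.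
(* Both hyperbolic densities carry the same nonnegative constant, which depends on [kappa] and the
   dimension alone, so on any domain the Euclidean inequality suffices. *)
have main D : measurable D -> D `<=` hyp_space k.+2 ->
    measurable_fun D (potential v) -> (forall x, D x -> 0 <= potential v x) ->
    (\int[lebesgue_rV k.+2]_(x in D) (potential v x)%:E
     <= \int[lebesgue_rV k.+2]_(x in D) (energy v x)%:E)%E ->
    (hyp_integral kappa D (fun x => (weight x * u x ^+ 2)%R)
     <= hyp_integral kappa D (fun x => (hyp_grad_norm kappa u x ^+ 2)%R))%E.
  move=> mD DU mp p0 le_pe.
  rewrite (hyp_integral_scale hkappa mD mp p0) => [|x /DU xU]; last first.
    have x1 : sqnorm x < 1 by rewrite -hyp_spaceE.
    by rewrite /weight weightE// potential_density// pE.
  have me : measurable_fun D (energy v).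
    apply: measurable_funTS; apply: continuous_measurable_fun_rV.
    exact: (continuous_energy cdv cK K1 v0).
  rewrite (hyp_integral_scale (g := energy v) hkappa mD me) => [|x _|x /DU xU].
  - by rewrite lee_wpmul2l// lee_fin divr_ge0 ?exprn_ge0// ltW.
  - exact: (energy_ge0 cK K1 v0).
  - have x1 : sqnorm x < 1 by rewrite -hyp_spaceE.
    by rewrite energy_density// eE.
split=> [rho rho0|].
  have [b b0 ->] := @hyp_ball_complement R k _ hkappa _ rho0.
  have D01 : [set x : 'rV[R]_k.+2 | b <= sqnorm x < 1] `<=`
      [set x | 0 < sqnorm x < 1].
    by move=> x /= /andP[bx x1]; rewrite x1 (lt_le_trans b0 bx).
  apply: main.
  - exact: measurable_annulus.
  - by move=> x /= /andP[_]; rewrite hyp_spaceE.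
  - apply: measurable_funS D01 (measurable_potential cv).
    exact: open_measurable_rV open_punctured_ball.
  - by move=> x /D01; exact: potential_ge0.
  - exact: (potential_le_energy cv dv cdv cK K1 v0 b0).
apply: main => //.
- exact: open_measurable_rV open_hyp_space.
- exact: (measurable_potentialT cv).
- by move=> x; rewrite hyp_spaceE; exact: potential_ge0T.
- exact: (potential_le_energyT cv dv cdv cK K1 v0).
Qed.
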